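(* Let $a\in(0,1/2)$. For $\lambda$-almost every $y\in[0,1]$, the following holds: for every set $A\subseteq\mathbb{N}$ with $$\overline{d}(A):=\limsup_{N\to\infty}\frac{|A\cap\{1,\dots,N\}|}{N}>0,$$ there exist $m,n\in\mathbb{N}$ such that $$\{m,m+n,m+2n\}\subseteq A\quad\text{and}\quad 0<2^n y \bmod 1<n^{-a}.$$
   Context: $\lambda$ denotes Lebesgue measure on $[0,1]$; $\mathbb{N}=\{1,2,\dots\}$; $2^n y\bmod 1$ is the fractional part of $2^n y$. *)

(* Defs.v *)
From HB Require Import structures.
From mathcomp Require Import all_boot all_order all_algebra finmap.
From mathcomp Require Import all_classical all_reals all_analysis.
Set Implicit Arguments.
Unset Strict Implicit.
Unset Printing Implicit Defensive.
Import Order.TTheory GRing.Theory Num.Theory.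
Import numFieldNormedType.Exports.
Local Open Scope classical_set_scope.
Local Open Scope ring_scope.

Definition frac_part (R : realType) (x : R) : R := x - (Num.floor x)%:~R.

(* The set given to fset_set is finite, so its cardinal is the true count.
   The term at N = 0 is 0 / 0 = 0 and does not affect the limsup. *)
Definition upper_density (R : realType) (A : set nat) : \bar R :=
  limn_esup (fun N : nat =>
    ((#|` fset_set (A `&` [set k | (1 <= k <= N)%N])|%fset)%:R / N%:R)%:E).

(* Main.v *)
Require Import Defs.
From HB Require Import structures.
From mathcomp Require Import all_boot all_order all_algebra finmap.
From mathcomp Require Import all_classical all_reals all_analysis.
From mathcomp Require Import zify ring lra.
Import Order.TTheory GRing.Theory Num.Theory.
Import numFieldNormedType.Exports.
Local Open Scope ring_scope.

(** Only differences n = l k with k < N are used, where p = 2^-l is roughly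
    (l N)^-a: if the k-th digit of y in base 2^l is 0 then the fractional part
    of 2^n y is below p <= n^-a.  For uniform y the indicators X_k of these
    events are independent with mean p.  Put w_k = X_k - p.  By Varnavides'
    form of Roth's theorem a dense subset A of an interval of length N contains
    at least c N^2 three-term progressions, so it suffices that the sum of w_k
    over all progressions of A with difference k is smaller than c p N^2.  By
    Cauchy-Schwarz and Fourier analysis this follows if
    |sum_k w_k w_(k+r) e(k theta)| is at most a small multiple of N p^2 for all
    r > 0 and all theta in a grid of 3 N points, and an exponential moment
    estimate shows that this fails with probability at most
    24 N^2 exp(-2 lambda^2 N p^2).  As a < 1/2, N can be taken exponential in l
    with N p^2 growing exponentially too, and Borel-Cantelli over l concludes.

    Roth's theorem itself is proved by Szemeredi's combinatorial argument with
    Hilbert cubes. *)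

(** * Roth's theorem *)

(** The exceptional set of [y] must serve all of the uncountably many sets [A] at once, so no union
    bound over [A] is possible. Cauchy-Schwarz is used to remove [A]: what remains is a condition on
    the products [w_n w_(n+r)], that is on [y] alone, made of about [N^2] inequalities. Exponential
    sums of [w] itself would not be enough: because of [2 n^2 = t^2 - 2 (t+n)^2 + (t+2n)^2], a
    quadratic phase in [w] can correlate with progressions. The diagonal of the Cauchy-Schwarz
    square costs [2 N^3] against a main term [(c p N^2)^2], and this is what forces [N p^2] to be
    large; under the constraint [l N <= 2^(l/a)] with [p = 2^-l] that needs [a < 1/2]. The constant
    [c] depends on the density of [A], which is unknown when the bad events are fixed; hence the
    tolerance in the correlation bounds tends to 0 with [l] instead of being chosen from [c]. *)

Definition ap3_free (A : pred nat) : Prop :=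
  forall m d, (0 < d)%N -> A m -> A (m + d)%N -> A (m + 2 * d)%N -> False.

Lemma ap3_free_affine (A : pred nat) (s d : nat) :
  ap3_free A -> (0 < d)%N -> ap3_free (fun j => A (s + d * j)%N).
Proof.
move=> fA d0 m e e0 Am Ae A2e; apply: (fA (s + d * m)%N (d * e)%N) => //.
- by rewrite muln_gt0 d0.
- by rewrite -addnA -mulnDr.
- by rewrite mulnCA -addnA -mulnDr.
Qed.

(** The constant [K] absorbs short intervals. Progression-freeness survives affine changes of
    variable, so the same [c] and [K] bound [A] on every arithmetic progression; this
    self-similarity drives the decrement of [c]. *)
Definition ap3_free_density_le (R : numDomainType) (c K : R) : Prop :=
  forall A : pred nat, ap3_free A ->
    forall n, \sum_(0 <= i < n) (A i)%:R <= c * n%:R + K.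

(** * Sums over residue classes and over runs *)

Section Sums.
Variable R : realDomainType.
Implicit Types (F G : nat -> R).

Lemma sum_nat_mul_residue F J D :
  \sum_(0 <= z < J * D) F z =
  \sum_(0 <= r < D) \sum_(0 <= j < J) F (r + D * j)%N.
Proof.
rewrite big_nat_mul exchange_big_nat /=; apply: eq_bigr => j _.
rewrite -{1}[(j * D)%N]add0n big_addn mulSn addnK.
by apply: eq_bigr => r _; rewrite mulnC.
Qed.

Lemma exists_ge_sum_le n F G : (0 < n)%N ->
  \sum_(0 <= i < n) F i <= \sum_(0 <= i < n) G i ->
  exists2 i, (i < n)%N & F i <= G i.
Proof.
move=> n0 leFG.
case: (boolP [exists i : 'I_n, F i <= G i]) => [/existsP[i Hi]|]; first by exists i.
rewrite negb_exists => /forallP H; exfalso.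
have : \sum_(0 <= i < n) G i < \sum_(0 <= i < n) F i.
  rewrite !big_mkord; apply: ltr_sum; first by apply/hasP; exists (Ordinal n0); rewrite ?mem_index_enum.
  by move=> i _; rewrite ltNge H.
by rewrite ltNge leFG.
Qed.

Lemma sum_le_nat m n F G : (forall i, (m <= i < n)%N -> F i <= G i) ->
  \sum_(m <= i < n) F i <= \sum_(m <= i < n) G i.
Proof.
move=> H; rewrite big_nat_cond [leRHS]big_nat_cond.
by apply: ler_sum => i; rewrite andbT; apply: H.
Qed.

End Sums.

Section Runs.
Variables (R : realDomainType) (A C : pred nat) (c K : R).
Hypothesis K_ge0 : 0 <= K.

(** The last sum counts the left ends of the maximal runs of [C]; each run costs one [K]. The
    induction strips off the run that ends at the last point. *)
Lemma sum_runs_le n :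
  (forall s e, \sum_(0 <= j < e) (A (s + j)%N)%:R <= c * e%:R + K) ->
  \sum_(0 <= i < n) (A i && C i)%:R <=
    c * (\sum_(0 <= i < n) (C i)%:R)
    + K * (\sum_(0 <= i < n) (C i && ~~ ((0 < i)%N && C i.-1))%:R).
Proof.
move=> HA; elim/ltn_ind: n => -[_|n IH]; first by rewrite !big_geq // !mulr0 addr0.
case Cn: (C n); last first.
  by rewrite !(big_nat_recr n) //= Cn andbF !addr0 IH.
(* [s] is the left end of the run of [C] through [n]. *)
have [s sP smin] : exists2 s, (s <= n)%N && [forall i : 'I_n.+1, (s <= i)%N ==> C i]
    & forall t, (t < s)%N -> exists2 i, (t <= i < s)%N & ~~ C i.
  pose P s := (s <= n)%N && [forall i : 'I_n.+1, (s <= i)%N ==> C i].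
  have exP : exists s, P s.
    exists n; rewrite /P leqnn; apply/forallP => i; apply/implyP => ni.
    by have -> : nat_of_ord i = n by have := ltn_ord i; lia.
  exists (ex_minn exP); case: ex_minnP => // s /andP[sn /forallP sC] smin.
  move=> t ts; case: (boolP [exists i : 'I_s, (t <= i)%N && ~~ C i]).
    by case/existsP => i /andP[ti nCi]; exists i; rewrite ?ti ?ltn_ord.
  rewrite negb_exists => /forallP H; exfalso.
  suff /smin : P t by lia.
  rewrite /P (leq_trans (ltnW ts) sn) /=; apply/forallP => i; apply/implyP => ti.
  case: (ltnP i s) => is_; last by have := sC i; rewrite is_.
  by have := H (Ordinal is_); rewrite /= ti /= negbK.
case/andP: sP => sn /forallP sC.
have CC i : (s <= i < n.+1)%N -> C i.
  by case/andP => si ni; have := sC (Ordinal ni); rewrite /= si.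
have startS : C s && ~~ ((0 < s)%N && C s.-1).
  rewrite CC ?leqnn //=; case: (posnP s) => // s0.
  have [i ii] := smin s.-1 ltac:(by rewrite prednK).
  by have -> : i = s.-1 by lia.
have sn1 := leqW sn.
rewrite !(@big_cat_nat _ _ _ s 0%N n.+1) //=.
have IHs := IH s sn.
have e1 : \sum_(s <= i < n.+1) (A i && C i)%:R <= c * (n.+1 - s)%:R + K.
  apply: le_trans (HA s (n.+1 - s)%N).
  rewrite -{1}[s]add0n big_addn; apply: sum_le_nat => i Hi.
  by rewrite addnC ler_nat; case: (A _) => //=; case: (C _).
have e2 : \sum_(s <= i < n.+1) (C i)%:R = (n.+1 - s)%:R :> R.
  rewrite (eq_big_nat _ _ (F2 := fun=> 1)); last by move=> i Hi; rewrite CC.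
  by rewrite sumr_const_nat.
have e3 : 1 <= \sum_(s <= i < n.+1) (C i && ~~ ((0 < i)%N && C i.-1))%:R :> R.
  rewrite big_ltn // startS ler_wpDr //; apply: sumr_ge0 => i _; exact: ler0n.
rewrite e2 !mulrDr.
have := ler_wpM2l K_ge0 e3; rewrite mulr1 => e4.
by lra.
Qed.

End Runs.

(** Inside a residue class modulo [D], runs become progressions of difference [D]; one starts at [z]
    when [z - D] is negative or outside [C]. *)
Lemma sum_ap_runs_le (R : realDomainType) (A C : pred nat) (c K : R) J D :
  0 <= K -> (0 < D)%N ->
  (forall s d e, (0 < d)%N ->
     \sum_(0 <= j < e) (A (s + d * j)%N)%:R <= c * e%:R + K) ->
  \sum_(0 <= z < J * D) (A z && C z)%:R <=
    c * (\sum_(0 <= z < J * D) (C z)%:R)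
    + K * (\sum_(0 <= z < J * D) (C z && ~~ ((D <= z)%N && C (z - D)%N))%:R).
Proof.
move=> K0 D0 HA; rewrite !sum_nat_mul_residue !mulr_sumr -big_split /=.
apply: sum_le_nat => r /andP[_ rD].
have := @sum_runs_le R (fun j => A (r + D * j)%N) (fun j => C (r + D * j)%N) c K K0 J.
move=> /(_ _)/le_trans; apply.
  move=> s e; apply: le_trans (HA (r + D * s)%N D e D0).
  by apply: sum_le_nat => j _; rewrite mulnDr addnA.
rewrite lerD2l ler_wpM2l //; apply: sum_le_nat => j _; rewrite ler_nat.
case: j => [|j] /=; first by rewrite muln0 addn0 (leqNgt D) rD.
by rewrite mulnS addnCA leq_addr addKn.
Qed.

Lemma sqr_sum_nat (R : comPzRingType) (u : nat -> R) w :
  (\sum_(0 <= i < w) u i) ^+ 2 = \sum_(0 <= i < w) u i ^+ 2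
    + 2 * \sum_(1 <= r < w) \sum_(0 <= i < w - r) u i * u (i + r)%N.
Proof.
elim: w => [|w IH]; first by rewrite !big_geq // mulr0 addr0 expr0n.
rewrite !(@big_nat_recr _ _ _ _ 0%N) //= sqrrD IH.
have -> : \sum_(1 <= r < w.+1) \sum_(0 <= i < w.+1 - r) u i * u (i + r)%N =
  \sum_(1 <= r < w) \sum_(0 <= i < w - r) u i * u (i + r)%N
  + (\sum_(0 <= i < w) u i) * u w.
  case: w {IH} => [|w]; first by rewrite !big_geq // mul0r addr0.
  rewrite (@big_nat_recr _ _ _ w.+1) //= subSnn big_nat1 add0n.
  rewrite (eq_big_nat _ _ (F2 := fun r => \sum_(0 <= i < w.+1 - r) u i * u (i + r)%N
     + u (w.+1 - r)%N * u w.+1)); last first.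
    move=> r /andP[r1 rw]; rewrite subSn ?(ltnW rw) // big_nat_recr //= subnK //.
    exact: ltnW.
  rewrite big_split /= -addrA; congr (_ + _).
  rewrite -mulr_suml -mulrDl; congr (_ * _).
  rewrite [RHS]big_nat_recl //= addrC big_add1 /= big_nat_rev /=.
  by congr (_ + _); apply: eq_big_nat => i Hi; congr u; lia.
by ring.
Qed.

(** * Hilbert cubes in dense sets *)

Fixpoint cube_offsets (ds : seq nat) : seq nat :=
  if ds is d :: ds' then cube_offsets ds' ++ map (addn d) (cube_offsets ds')
  else [:: 0%N].

(** The square of the count is the diagonal plus twice the number of pairs, sorted by difference;
    averaging over the [w - 1] differences finds a popular one. The hypothesis [2 <= eta * w%:R]
    keeps the diagonal below half of the square. *)
Lemma exists_popular_difference (R : realFieldType) (A : pred nat) (eta : R) s w :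
  0 < eta -> 2 <= eta * w%:R ->
  eta * w%:R <= \sum_(0 <= i < w) (A (s + i)%N)%:R ->
  exists2 d, (0 < d <= w)%N &
    eta ^+ 2 / 4 * w%:R <= \sum_(0 <= i < w) (A (s + i)%N && A (s + i + d)%N)%:R.
Proof.
move=> eta0 ew2 HS.
set S := \sum_(0 <= i < w) _ in HS.
have Sw : S <= w%:R.
  have -> : w%:R = \sum_(0 <= i < w) (1 : R) by rewrite sumr_const_nat subn0.
  by apply: sum_le_nat => i _; rewrite lern1 leq_b1.
have w2 : (2 <= w)%N by rewrite -(ler_nat R); lra.
have sq := @sqr_sum_nat R (fun i => (A (s + i)%N)%:R) w.
rewrite -/S in sq.
rewrite (eq_big_nat _ _ (F2 := fun i => (A (s + i)%N)%:R)) -/S in sq; last first.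
  by move=> i _; case: (A _); rewrite ?expr0n ?expr1n.
rewrite big_add1 /= in sq.
have [] := @exists_ge_sum_le R w.-1 (fun=> eta ^+ 2 / 4 * w%:R)
  (fun r => \sum_(0 <= i < w - r.+1) (A (s + i)%N)%:R * (A (s + (i + r.+1))%N)%:R).
- by rewrite -subn1 subn_gt0.
- rewrite sumr_const_nat subn0 -[_ *+ w.-1]mulr_natr -subn1 natrB ?(ltnW w2) //.
  have : eta * w%:R * (eta * w%:R - 1) <= S * (S - 1) by nra.
  set X := eta * w%:R in ew2 HS * => h.
  have X2 : 2 * X <= X * X by nra.
  have -> : eta ^+ 2 / 4 * w%:R * (w%:R - 1) = X * X / 4 - X * eta / 4 by rewrite /X; field.
  have Xe : 0 <= X * eta by nra.
  by move: sq; rewrite expr2 subn1; set T := \sum_(0 <= i < w.-1) _ => sq; lra.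
move=> r rw Hr; exists r.+1; first by lia.
apply: le_trans Hr _.
rewrite [leRHS](@big_cat_nat _ _ _ (w - r.+1)%N) //= ?leq_subr //.
rewrite ler_wpDr ?sumr_ge0 //.
by apply: sum_le_nat => i _; rewrite -natrM mulnb addnA.
Qed.

(** Keeping only the points [z] with both [z] and [z + d] in [A], for a popular [d], adds one
    dimension and turns density [eta] into [eta ^+ 2 / 4]. [W] does not depend on [A], so the
    generators can stay bounded while the ambient interval grows. *)
Lemma exists_hilbert_cube (R : archiRealFieldType) k (eta : R) : 0 < eta ->
  exists2 W, (0 < W)%N & forall w (A : pred nat) s, (W <= w)%N ->
    eta * w%:R <= \sum_(0 <= i < w) (A (s + i)%N)%:R ->
    exists x ds, [/\ (s <= x < s + w)%N, size ds = k,
      all (fun d => 0 < d <= w)%N ds & all (fun e => A (x + e)%N) (cube_offsets ds)].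
Proof.
elim: k eta => [|k IH] eta eta0.
  exists 1%N => // w A s w0 HS.
  have [] := @exists_ge_sum_le R w (fun=> eta) (fun i => (A (s + i)%N)%:R) w0.
    by rewrite sumr_const_nat subn0 -mulr_natr.
  move=> i iw; case Ai: (A _); last by move=> /(lt_le_trans eta0); rewrite ltxx.
  by move=> _; exists (s + i)%N, [::]; split => //=; rewrite ?addn0 ?Ai //; lia.
have [W W0 HW] := IH (eta ^+ 2 / 4) ltac:(by rewrite divr_gt0 // exprn_gt0).
exists (maxn W (Num.bound (2 / eta))); first by lia.
move=> w A s; rewrite geq_max => /andP[Ww bw] HS.
have ew2 : 2 <= eta * w%:R.
  rewrite mulrC -ler_pdivrMr //; apply: le_trans (_ : (Num.bound (2 / eta))%:R <= _).
    by apply/ltW/archi_boundP; rewrite divr_ge0 // ltW.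
  by rewrite ler_nat.
have [d dw Hd] := exists_popular_difference R A eta s w eta0 ew2 HS.
have [x [ds [xs sz dsw cube]]] := HW w (fun z => A z && A (z + d)%N) s Ww Hd.
exists x, (d :: ds); split => //=; rewrite ?sz ?dw //.
rewrite all_cat all_map; apply/andP; split; apply: sub_all cube => e /= /andP[] //.
by rewrite -addnA [(e + d)%N]addnC.
Qed.

Lemma sum_nat_support (V : nmodType) (F : nat -> V) n n' : (n <= n')%N ->
  (forall z, (n <= z)%N -> F z = 0) ->
  \sum_(0 <= z < n') F z = \sum_(0 <= z < n) F z.
Proof.
move=> nn' F0; rewrite (@big_cat_nat _ _ _ n 0%N n') //= [X in _ + X]big_nat_cond [X in _ + X]big1 ?addr0 //.
by move=> z /andP[/andP[nz _] _]; rewrite F0.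
Qed.

(** Telescoping along the suffixes of [ds]: the increments add up to [F ds - F [::]], so one of them
    is at most the average. *)
Lemma exists_small_increment (R : realFieldType) (F : seq nat -> R) ds :
  0 <= F [::] -> (0 < size ds)%N ->
  exists pre d ds', ds = pre ++ d :: ds' /\
    (size ds)%:R * (F (d :: ds') - F ds') <= F ds.
Proof.
move=> F0 s0.
have [] := @exists_ge_sum_le R (size ds)
  (fun i => (size ds)%:R * (F (drop i ds) - F (drop i.+1 ds))) (fun=> F ds) s0.
  rewrite -mulr_sumr sumr_const_nat subn0 -[F ds *+ _]mulr_natl ler_wpM2l //.
  rewrite -[leLHS]opprK -sumrN.
  under eq_bigr do rewrite opprB.
  rewrite telescope_sumr // drop_size drop0 opprB lerBlDr lerDl //.
move=> i isz; rewrite {1}(drop_nth 0%N isz) => H.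
exists (take i ds), (nth 0%N ds i), (drop i.+1 ds); split => //.
by rewrite -drop_nth // cat_take_drop.
Qed.

(* With a cube [x + cube_offsets ds] inside A, these are the third terms
   [2 q - b] of the progressions with first term b in A below x and second
   term q in the cube; a progression-free A avoids all of them. *)
Definition third_terms (A : pred nat) (x : nat) (ds : seq nat) : pred nat :=
  fun z => has (fun e => (2 * e <= z)%N &&
    ((x < z - 2 * e <= 2 * x)%N && A (2 * x - (z - 2 * e))%N)) (cube_offsets ds).

(** The generator [d] adjoins the translate by [2 * d]; a small increment of the count therefore
    means near invariance under this translation. *)
Lemma third_terms_cons A x d ds z :
  third_terms A x (d :: ds) z =
  third_terms A x ds z || ((2 * d <= z)%N && third_terms A x ds (z - 2 * d)%N).
Proof.
rewrite /third_terms /= has_cat has_map; congr (_ || _).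
elim: (cube_offsets ds) => [|e s IH] /=; first by rewrite andbF.
rewrite IH andb_orr; congr (_ || _).
by rewrite mulnDr subnDA [RHS]andbA; congr (_ && _); lia.
Qed.

Lemma third_terms_disjoint A x ds z : ap3_free A ->
  all (fun e => A (x + e)%N) (cube_offsets ds) -> third_terms A x ds z -> ~~ A z.
Proof.
move=> fA /allP cube /hasP[e eds /and3P[ez zx Ab]]; apply/negP => Az.
apply: (fA (2 * x - (z - 2 * e))%N (z - e - x)%N _ Ab); first by lia.
- by have := cube e eds; congr A; lia.
- by move: Az; congr A; lia.
Qed.

Lemma all_cube_offsets_suffix (P : pred nat) pre ds :
  all P (cube_offsets (pre ++ ds)) -> all P (cube_offsets ds).
Proof. by elim: pre => //= d pre IH; rewrite all_cat => /andP[/IH]. Qed.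

Section CubeStep.
Variables (R : realFieldType) (A : pred nat) (c K : R).
Hypotheses (A_free : ap3_free A) (c_ge0 : 0 <= c) (K_ge0 : 0 <= K).
Hypothesis dens : ap3_free_density_le R c K.

(** The offset 0 occurs in every cube, and alone it yields the reflection in [x] of the part of [A]
    below [x]. *)
Lemma sum_third_terms_ge n x ds : (2 * x < n)%N ->
  \sum_(0 <= i < x) (A i)%:R <= \sum_(0 <= z < n) (third_terms A x ds z)%:R :> R.
Proof.
move=> xn; have sub z : (x < z <= 2 * x)%N -> A (2 * x - z)%N -> third_terms A x ds z.
  move=> zx Az; elim: ds => [|d ds IH]; last by rewrite third_terms_cons IH.
  by rewrite /third_terms /= muln0 subn0 zx Az.
rewrite (@big_cat_nat _ _ _ x.+1 0%N n) //=; last by lia.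
rewrite (@big_cat_nat _ _ _ (2 * x).+1 x.+1 n) //=; try lia.
apply: ler_wpDl; first by rewrite sumr_ge0.
apply: ler_wpDr; first by rewrite sumr_ge0.
rewrite -[x.+1]add0n big_addn subSS (_ : 2 * x - x = x)%N; last by lia.
rewrite big_nat_rev /=; apply: sum_le_nat => i Hi; rewrite ler_nat.
case Ai: (A _) => //; rewrite sub //; first by lia.
by apply: etrans Ai; congr A; lia.
Qed.

(** Some generator [d] adds at most a share [1 / size ds] of the third terms. The complement of the
    third terms of [ds'] contains [A] and is nearly invariant under [2 * d], so it splits into few
    progressions of difference [2 * d], and the density bound applies to each. *)
Lemma ap3_free_cube_bound n x ds w : (2 * x < n)%N -> (0 < size ds)%N ->
  all (fun d => 0 < d <= w)%N ds -> all (fun e => A (x + e)%N) (cube_offsets ds) ->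
  (size ds)%:R * (\sum_(0 <= i < n) (A i)%:R) <=
  (size ds)%:R * (c * (n%:R - \sum_(0 <= i < x) (A i)%:R))
  + K * (2 * w%:R * (size ds)%:R + n%:R).
Proof.
move=> xn s0 dsw cube.
pose F ds : R := \sum_(0 <= z < n) (third_terms A x ds z)%:R.
have [|pre [d [ds' [Eds small]]]] := @exists_small_increment R F ds _ s0.
  by rewrite sumr_ge0.
have dw : (0 < d <= w)%N by move: dsw; rewrite Eds all_cat /= => /and3P[].
have cube' : all (fun e => A (x + e)%N) (cube_offsets ds').
  by apply: (@all_cube_offsets_suffix _ (pre ++ [:: d])); rewrite -catA -Eds.
have Fn : F ds <= n%:R.
  have -> : n%:R = \sum_(0 <= i < n) (1 : R) by rewrite sumr_const_nat subn0.
  by apply: sum_le_nat => i _; rewrite lern1 leq_b1.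
pose C z := (z < n)%N && ~~ third_terms A x ds' z.
have D0 : (0 < 2 * d)%N by lia.
(* [sum_ap_runs_le] wants a multiple of [2 * d]; as [C] vanishes from [n] on, the longer range
   changes no sum. *)
have nD : (n <= n * (2 * d))%N by rewrite leq_pmulr.
have := @sum_ap_runs_le R A C c K n (2 * d)%N K_ge0 D0.
have H s e m : (0 < e)%N -> \sum_(0 <= j < m) (A (s + e * j)%N)%:R <= c * m%:R + K.
  by move=> e0; apply: dens; apply: ap3_free_affine.
move=> /(_ H).
rewrite !(@sum_nat_support _ _ n _ nD); try by move=> z nz; rewrite /C ltnNge nz /= ?andbF.
have -> : \sum_(0 <= z < n) (A z && C z)%:R = \sum_(0 <= z < n) (A z)%:R :> R.
  apply: eq_big_nat => z /andP[_ zn]; rewrite /C zn /=; case: (boolP (A z)) => //= Az.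
  by case: (boolP (third_terms _ _ _ _)) => //
    /(third_terms_disjoint _ _ _ _ A_free cube'); rewrite Az.
have -> : \sum_(0 <= z < n) (C z)%:R = n%:R - F ds'.
  have -> : n%:R = \sum_(0 <= i < n) (1 : R) by rewrite sumr_const_nat subn0.
  rewrite -sumrB; apply: eq_big_nat => z /andP[_ zn]; rewrite /C zn /=.
  by case: (third_terms _ _ _ _); rewrite ?subrr ?subr0.
set st := \sum_(0 <= z < n) (C z && _)%:R => main.
(* A run starts below [2 * d], or at a third term that the generator [d] has just added. *)
have stle : st <= 2 * w%:R + (F (d :: ds') - F ds').
  apply: le_trans (_ : \sum_(0 <= z < n) ((z < 2 * d)%N%:R
     + ((third_terms A x (d :: ds') z)%:R - (third_terms A x ds' z)%:R)) <= _).
    apply: sum_le_nat => z /andP[_ zn]; rewrite /C zn /= third_terms_cons.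
    have zd : (z - 2 * d < n)%N by lia.
    rewrite zd /= (ltnNge z); case: (third_terms A x ds' z) => /=.
      by rewrite subrr addr0.
    by case: (leqP (2 * d) z) => //= _; rewrite ?negbK ?add0r ?subr0 // ?addr0.
  rewrite big_split /= sumrB lerD2r.
  apply: le_trans (_ : (2 * d)%:R <= _); last by rewrite natrM ler_wpM2l // ler_nat; lia.
  case: (leqP (2 * d) n) => dn.
    rewrite (@sum_nat_support _ _ (2 * d) _ dn); last by move=> z; rewrite leqNgt => /negbTE->.
    have -> : (2 * d)%:R = \sum_(0 <= i < 2 * d) (1 : R) by rewrite sumr_const_nat subn0.
    by apply: sum_le_nat => i _; rewrite lern1 leq_b1.
  apply: le_trans (_ : n%:R <= _); last by rewrite ler_nat ltnW.
  have -> : n%:R = \sum_(0 <= i < n) (1 : R) by rewrite sumr_const_nat subn0.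
  by apply: sum_le_nat => i _; rewrite lern1 leq_b1.
have Fge := @sum_third_terms_ge n x ds' xn; rewrite -/(F ds') in Fge.
have k0 : 0 <= (size ds)%:R :> R by [].
apply: le_trans (ler_wpM2l k0 main) _.
rewrite mulrDr; apply: lerD.
  by rewrite ler_wpM2l // ler_wpM2l // lerD2l lerN2.
rewrite mulrCA ler_wpM2l //.
apply: le_trans (ler_wpM2l k0 stle) _; rewrite mulrDr lerD //; first by rewrite mulrC.
exact: le_trans Fn.
Qed.
End CubeStep.

(** * The density decrement *)

Lemma sum_pred_le (R : numDomainType) (A : pred nat) m n :
  \sum_(m <= i < n) (A i)%:R <= (n - m)%:R :> R.
Proof.
have -> : (n - m)%:R = \sum_(m <= i < n) (1 : R) by rewrite sumr_const_nat.
by apply: ler_sum => i _; rewrite lern1 leq_b1.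
Qed.

Lemma ap3_free_density_shift (R : realDomainType) (c K : R) A m n :
  ap3_free_density_le R c K -> ap3_free A -> (m <= n)%N ->
  \sum_(m <= i < n) (A i)%:R <= c * (n - m)%:R + K.
Proof.
move=> dens fA mn; apply: le_trans (dens _ (ap3_free_affine A m 1 fA isT) (n - m)%N).
rewrite -[X in \sum_(X <= _ < _) _]add0n big_addn.
by apply: sum_le_nat => i _; rewrite mul1n addnC.
Qed.

Lemma exists_mul4_floor n w : (0 < w)%N ->
  exists u, (4 * (u * w) <= n < 4 * (u * w) + 4 * w)%N.
Proof.
move=> w0; exists (n %/ (4 * w))%N.
have : (n %% (4 * w) < 4 * w)%N by rewrite ltn_mod muln_gt0.
have := divn_eq n (4 * w); move: (n %/ _)%N (n %% _)%N => q r.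
by rewrite [(q * _)%N]mulnCA => ->; rewrite leq_addr ltn_add2l.
Qed.

(** If [A] had almost density [c] on a long interval, a cube of [A] in its second quarter would
    produce about [c * n / 4] third terms, all missed by [A]. On their complement the density of [A]
    is still at most about [c], so about [c ^+ 2 * n / 4] points are lost. *)
Lemma ap3_free_density_step (R : archiRealFieldType) (delta c K : R) :
  0 < delta -> delta <= c -> c <= 1 -> 0 <= K -> ap3_free_density_le R c K ->
  exists2 K', 0 <= K' & ap3_free_density_le R (c - delta ^+ 2 / 32) K'.
Proof.
move=> d0 dc c1 K0 dens.
set gam := delta ^+ 2 / 32.
have gam0 : 0 < gam by rewrite divr_gt0 // exprn_gt0.
have gamd : gam <= delta / 32 by rewrite /gam expr2; nra.
have c0 : 0 <= c by lra.
(* Dimension [k] brings the cost [K * n / k] of the runs down to [gam * n]. *)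
have [k [kp Kk]] : exists k, (0 < k)%N /\ K <= gam * k%:R.
  exists (Num.bound (K / gam)).+1; split => //; rewrite mulrC -ler_pdivrMr //.
  apply/ltW; apply: lt_le_trans (archi_boundP _) _; first by rewrite divr_ge0 // ltW.
  by rewrite ler_nat.
have [w w0 Hcube] := @exists_hilbert_cube R k (delta / 2) ltac:(lra).
pose wr : R := w%:R.
have wr0 : 0 <= wr by [].
(* The summands guarantee in turn a quarter of length at least [w], enough density of [A] in the
   second quarter, and bounded errors below [gam * n]. *)
pose n1 := Num.bound (4 * wr + 12 * (wr + 2 * K) / delta + (wr + K + 2 * K * wr) / gam).
have n1P : 4 * wr + 12 * (wr + 2 * K) / delta + (wr + K + 2 * K * wr) / gam < n1%:R.
  have ? := ltW d0; have ? := ltW gam0.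
  by apply: archi_boundP; do ![done|apply: addr_ge0|apply: mulr_ge0|rewrite invr_ge0].
exists n1%:R; first by [].
move=> A fA n; set S := \sum_(0 <= i < n) _.
have Sn : S <= n%:R by have := @sum_pred_le R A 0 n; rewrite subn0.
have n0 : 0 <= n%:R :> R by [].
case: (ltnP n n1) => nn1.
  have : n%:R <= n1%:R :> R by rewrite ler_nat ltnW.
  have ? : 0 <= (c - gam) * n%:R by rewrite mulr_ge0 //; lra.
  by lra.
suff : S <= (c - gam) * n%:R by move/le_trans; apply; rewrite lerDl.
rewrite leNgt; apply/negP => HS.
have nbig : 4 * wr + 12 * (wr + 2 * K) / delta + (wr + K + 2 * K * wr) / gam < n%:R.
  by apply: lt_le_trans n1P _; rewrite ler_nat.
have q1 : 0 <= 12 * (wr + 2 * K) / delta.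
  by rewrite mulr_ge0 ?invr_ge0 ?(ltW d0) // mulr_ge0 // addr_ge0 // mulr_ge0.
have q2 : 0 <= (wr + K + 2 * K * wr) / gam.
  by rewrite mulr_ge0 ?invr_ge0 ?(ltW gam0) // !addr_ge0 ?mulr_ge0.
have n2 : 12 * (wr + 2 * K) < delta * (n%:R - 4 * wr).
  by rewrite [ltRHS]mulrC -ltr_pdivrMr //; lra.
have n3 : wr + K + 2 * K * wr < gam * n%:R.
  by rewrite [ltRHS]mulrC -ltr_pdivrMr //; lra.
(* [P = u * w] is a quarter of [n] up to [w]: [[P, 2P)] splits into windows of length [w], and each
   [x] in it has [2 * x < n] and at least about [n / 4] points below it. *)
have [u P4] := exists_mul4_floor n w w0.
have [P EP] : exists P, P = (u * w)%N by exists (u * w)%N.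
rewrite -EP in P4.
have [P2 Pn] : (P <= 2 * P)%N /\ (2 * P <= n)%N by clear -P4; lia.
pose p : R := P%:R.
have p1 : 4 * p <= n%:R by rewrite -natrM ler_nat; case/andP: P4.
have p2 : n%:R <= 4 * p + 4 * wr.
  by rewrite -!natrM -natrD ler_nat; case/andP: P4 => _ /ltnW.
have u0 : (0 < u)%N.
  case: (posnP u) => // u0; exfalso; move: p2 q1 q2; rewrite /p EP u0 mul0n; lra.
have fst_ : \sum_(0 <= i < P) (A i)%:R <= c * p + K by exact: dens.
have lst_ : \sum_(2 * P <= i < n) (A i)%:R <= c * (n%:R - 2 * p) + K.
  have := @ap3_free_density_shift R c K A (2 * P) n dens fA Pn.
  by rewrite natrB ?natrM.
have Ssplit : S = \sum_(0 <= i < P) (A i)%:R + \sum_(P <= i < 2 * P) (A i)%:R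
    + \sum_(2 * P <= i < n) (A i)%:R.
  by rewrite -addrA -!big_cat_nat //= (leq_trans P2).
(* Outside the second quarter [A] has density at most about [c], so a nearly extremal [A] cannot be
   sparse inside it. *)
have mid : delta / 2 * p <= \sum_(P <= i < 2 * P) (A i)%:R.
  have : (c - gam) * n%:R <= c * (n%:R - p) + 2 * K + \sum_(P <= i < 2 * P) (A i)%:R by lra.
  have : gam * n%:R <= delta / 32 * n%:R by rewrite ler_wpM2r.
  have : delta * p <= c * p by rewrite ler_wpM2r.
  have : delta * n%:R <= delta * (4 * p + 4 * wr) by rewrite ler_wpM2l // ltW.
  have : delta * wr <= wr by rewrite ler_piMl //; lra.
  by lra.
have [j ju Hj] : exists2 j, (j < u)%N &
    delta / 2 * wr <= \sum_(0 <= i < w) (A (P + j * w + i)%N)%:R.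
  apply: exists_ge_sum_le => //.
  rewrite sumr_const_nat subn0 (_ : _ *+ u = delta / 2 * p); last first.
    by rewrite -[LHS]mulr_natr /p EP natrM -/wr; ring.
  apply: le_trans mid _.
  rewrite -[X in \sum_(X <= _ < _) _]add0n big_addn (_ : 2 * P - P = u * w)%N; last by rewrite -EP mul2n -addnn addnK.
  rewrite big_nat_mul; apply: sum_le_nat => i _.
  rewrite -[X in \sum_(X <= _ < _) _]add0n big_addn mulSn addnK.
  by apply: sum_le_nat => z _; rewrite [(z + _)%N]addnC addnAC [(_ + P)%N]addnC.
have [x [ds [xs sz dsw cube]]] := Hcube w A _ (leqnn w) Hj.
have xP : (P <= x < 2 * P)%N.
  have : (j.+1 * w <= u * w)%N by rewrite leq_mul2r ju orbT.
  by rewrite mulSn -EP; clear -xs; lia.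
have [xn xn'] : (2 * x < n)%N /\ (x <= n)%N by clear -xP P4; lia.
have kp' : (0 < size ds)%N by rewrite sz.
have := @ap3_free_cube_bound R A c K fA c0 K0 dens n x ds w xn kp' dsw cube.
rewrite -/S sz; set Sx := \sum_(0 <= i < x) _ => main.
have Sxle : c * p - gam * n%:R - K <= Sx.
  have := @ap3_free_density_shift R c K A x n dens fA xn'.
  have ES : S = Sx + \sum_(x <= i < n) (A i)%:R by exact: big_cat_nat.
  rewrite natrB //.
  have : c * p <= c * x%:R by rewrite ler_wpM2l // ler_nat; case/andP: xP.
  by lra.
have kr0 : 0 < k%:R :> R by rewrite ltr0n.
have main' : S <= c * (n%:R - Sx) + 2 * K * wr + gam * n%:R.
  rewrite -(ler_pM2l kr0); apply: le_trans main _.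
  have : K * n%:R <= gam * k%:R * n%:R by rewrite ler_wpM2r.
  by rewrite /wr; lra.
(* The gain is at least [delta ^+ 2 * n / 4 = 8 * gam * n]; the losses are [gam * n] each from [HS],
   from the runs, from [Sxle] and from [n3]. *)
have a1 : c * (c * p - gam * n%:R - K) <= c * Sx by rewrite ler_wpM2l.
have a2 : c * K <= K by rewrite ler_piMl.
have a3 : c * (gam * n%:R) <= gam * n%:R by rewrite ler_piMl // mulr_ge0 // ltW.
have a4 : c * (c * (n%:R / 4 - wr)) <= c * (c * p) by do 2 rewrite ler_wpM2l //; lra.
have a5 : c * (c * wr) <= wr.
  by rewrite mulrA ler_piMl // mulr_ile1.
have a6 : delta ^+ 2 * n%:R <= c * (c * n%:R).
  by rewrite mulrA ler_wpM2r // expr2 ler_pM // ltW.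
have a7 : delta ^+ 2 * n%:R = 32 * (gam * n%:R) by rewrite /gam; field.
have a8 : 0 <= gam * n%:R by rewrite mulr_ge0 // ltW.
lra.
Qed.

Lemma ap3_free_density_mono (R : realDomainType) (c c' K : R) : c <= c' ->
  ap3_free_density_le R c K -> ap3_free_density_le R c' K.
Proof.
by move=> cc' dens A fA n; apply: le_trans (dens A fA n) _; rewrite lerD2r ler_wpM2r.
Qed.

(** The trivial bound [c = 1] is lowered by [gam], which depends on [delta] only, until it reaches
    [delta]; about [1 / gam] rounds suffice. *)
Theorem roth (R : archiRealFieldType) (delta : R) : 0 < delta ->
  exists2 K, 0 <= K & ap3_free_density_le R delta K.
Proof.
move=> d0; pose gam := delta ^+ 2 / 32.
have gam0 : 0 < gam by rewrite divr_gt0 // exprn_gt0.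
have iter j c K : c <= 1 -> c <= delta + j%:R * gam -> 0 <= K ->
    ap3_free_density_le R c K -> exists2 K, 0 <= K & ap3_free_density_le R delta K.
  elim: j c K => [|j IH] c K c1 cj K0 dens.
    by exists K => //; apply: ap3_free_density_mono dens; lra.
  case: (leP c delta) => dc; first by exists K => //; apply: ap3_free_density_mono dens.
  have [K' K'0 dens'] := @ap3_free_density_step R delta c K d0 (ltW dc) c1 K0 dens.
  by apply: IH dens' => //; rewrite -/gam; move: cj; rewrite -natr1; lra.
apply: (iter (Num.bound gam^-1) 1 0) => //.
  have : gam^-1 < (Num.bound gam^-1)%:R by apply: archi_boundP; rewrite invr_ge0 ltW.
  by rewrite -[gam^-1]mul1r ltr_pdivrMr //; lra.
by move=> A _ n; rewrite mul1r addr0 -[n in leRHS]subn0; apply: sum_pred_le.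
Qed.

(** * Varnavides' theorem *)

Definition ap3_at (A : pred nat) (t n : nat) : bool :=
  [&& A t, A (t + n)%N & A (t + 2 * n)%N].

Lemma sum_multiples_le (R : realDomainType) (H : nat -> R) D e N :
  (forall n, 0 <= H n) -> (0 < e)%N -> (D * e < N)%N ->
  \sum_(1 <= d < D.+1) H (d * e)%N <= \sum_(1 <= n < N) H n.
Proof.
move=> H0 e0; elim: D N => [|D IH] N DN; first by rewrite big_geq // sumr_ge0.
rewrite big_nat_recr //= (@big_cat_nat _ _ _ (D.+1 * e)%N 1%N N) //=; try by lia.
apply: lerD; first by apply: IH; rewrite mulSn -[ltnLHS]add0n ltn_add2r.
by rewrite big_ltn // ler_wpDr // sumr_ge0.
Qed.

Lemma exists_ap3_of_dense (R : realFieldType) (B : pred nat) (c K : R) M :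
  ap3_free_density_le R c K -> c * M%:R + K < \sum_(0 <= i < M) (B i)%:R ->
  exists i e, [/\ (i < M)%N, (0 < e < M)%N & ap3_at B i e].
Proof.
move=> dens HB.
case: (boolP [exists i : 'I_M, [exists e : 'I_M, (0 < e)%N && ap3_at B i e]]).
  by case/existsP => i /existsP[e /andP[e0 ap]]; exists i, e; rewrite !ltn_ord e0.
move=> /existsPn nap; exfalso; move: HB; apply/negP; rewrite -leNgt.
apply: le_trans (dens (fun i => (i < M)%N && B i) _ M).
  by apply: sum_le_nat => i /andP[_ ->].
move=> m d d0 /andP[mM Bm] /andP[_ Bmd] /andP[m2M Bm2].
have dM : (d < M)%N by lia.
have /existsPn/(_ (Ordinal dM)) := nap (Ordinal mM).
by rewrite /= d0 /ap3_at Bm Bmd Bm2.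
Qed.

(** Support in [[N, 2N)] leaves a gap of length [N] on the left, so a shift by [d <= N] pushes
    nothing below 0. *)
Lemma sum_shift_support (V : nmodType) (F : nat -> V) N d : (d <= N)%N ->
  (forall z, ~~ (N <= z < 2 * N)%N -> F z = 0) ->
  \sum_(0 <= x < 2 * N) F (x + d)%N = \sum_(0 <= x < 2 * N) F x.
Proof.
move=> dN F0.
have -> : \sum_(0 <= x < 2 * N) F (x + d)%N = \sum_(d <= x < 2 * N + d) F x.
  by rewrite -[X in _ = \sum_(X <= _ < _) _]add0n big_addn addnK.
transitivity (\sum_(d <= x < 2 * N) F x).
  rewrite (@big_cat_nat _ _ _ (2 * N)%N d) //=; try lia.
  rewrite [X in _ + X]big_nat_cond [X in _ + X]big1 ?addr0 // => z /andP[/andP[nz _] _].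
  by rewrite F0 // negb_and -leqNgt nz orbT.
rewrite [RHS](@big_cat_nat _ _ _ d 0%N) //=; last by lia.
rewrite [X in _ = X + _]big_nat_cond [X in _ = X + _]big1 ?add0r // => z /andP[/andP[_ zd] _].
by rewrite F0 // negb_and -!ltnNge (leq_trans zd dN).
Qed.

(** Roth's theorem is applied to windows [x + i * d], [i < M], of fixed length [M]. For each [d] up
    to [N / M] many windows are dense and contain a progression, while a given progression is met
    through at most [M ^+ 2] pairs [(i, e)]. *)
Theorem varnavides (R : archiRealFieldType) (delta : R) : 0 < delta ->
  exists (c : R) N0, 0 < c /\ forall N (A : pred nat), (N0 <= N)%N ->
    (forall i, A i -> (N <= i < 2 * N)%N) ->
    delta * N%:R <= \sum_(0 <= i < 2 * N) (A i)%:R ->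
    c * N%:R ^+ 2 <= \sum_(1 <= n < N) \sum_(0 <= t < 2 * N) (ap3_at A t n)%:R.
Proof.
move=> d0; have [K K0 dens] := @roth R (delta / 8) ltac:(lra).
have [M [M0 KM]] : exists M, (0 < M)%N /\ K < delta / 8 * M%:R.
  exists (Num.bound (K / (delta / 8))).+1; split => //.
  rewrite [ltRHS]mulrC -ltr_pdivrMr; last by lra.
  apply: lt_le_trans (archi_boundP _) _; last by rewrite ler_nat.
  by rewrite divr_ge0 //; lra.
have Mr0 : 0 < M%:R :> R by rewrite ltr0n.
exists (delta / (4 * M%:R ^+ 3)), M; split.
  by rewrite divr_gt0 // mulr_gt0 // exprn_gt0.
move=> N A MN supp; set S := \sum_(0 <= i < 2 * N) _ => HS.
set T := \sum_(1 <= n < N) _.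
(* [D * M <= N] keeps the shifts [i * d] within the empty gap below [N] and the differences [d * e]
   below [N]. *)
pose D := (N %/ M)%N.
have DM : (D * M <= N)%N by exact: leq_trunc_div.
have D1 : (N <= 2 * D * M)%N.
  have := ltn_ceil N M0; rewrite -/D mulSn; clear -DM MN M0 => H.
  have : (M <= D * M)%N by rewrite leq_pmull // divn_gt0.
  by rewrite -mulnA mul2n -addnn; lia.
pose G d x : R := \sum_(0 <= i < M) \sum_(1 <= e < M) (ap3_at A (x + i * d) (d * e))%:R.
have G0 d x : 0 <= G d x by rewrite sumr_ge0 // => i _; rewrite sumr_ge0.
have sumG d : (0 < d < D.+1)%N -> delta / 2 * N%:R <= \sum_(0 <= x < 2 * N) G d x.
  move=> /andP[dp dD].
  (* Either the window has density at most [delta / 4], or Roth's theorem gives [1 <= G d x] and the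
     trivial bound [M] suffices. *)
  have Pd x : \sum_(0 <= i < M) (A (x + i * d)%N)%:R <= delta / 4 * M%:R + M%:R * G d x.
    case: (leP (\sum_(0 <= i < M) (A (x + i * d)%N)%:R) (delta / 4 * M%:R)) => [H|H].
      by apply: le_trans H _; rewrite lerDl mulr_ge0.
    have [i [e [iM eM ap]]] := @exists_ap3_of_dense R (fun i => A (x + i * d)%N)
      (delta / 8) K M dens ltac:(lra).
    have ap' : ap3_at A (x + i * d) (d * e).
      case/and3P: ap => a1 a2 a3; apply/and3P; split => //.
        by apply: etrans a2; congr A; ring.
      by apply: etrans a3; congr A; ring.
    have G1 : 1 <= G d x.
      rewrite /G (@big_cat_nat _ _ _ i 0%N M) //= ?(ltnW iM) //.
      rewrite ler_wpDl ?sumr_ge0 //; first by move=> j _; rewrite sumr_ge0.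
      rewrite big_ltn // ler_wpDr ?sumr_ge0 //; first by move=> j _; rewrite sumr_ge0.
      case/andP: eM => e1 eM.
      rewrite (@big_cat_nat _ _ _ e 1%N M) //= ?(ltnW eM) //.
      by rewrite ler_wpDl ?sumr_ge0 // big_ltn // ap' ler_wpDr ?sumr_ge0.
    have := @sum_pred_le R (fun i => A (x + i * d)%N) 0 M; rewrite subn0.
    have : M%:R <= M%:R * G d x by rewrite ler_peMr.
    have : 0 <= delta / 4 * M%:R by rewrite mulr_ge0 //; lra.
    by lra.
  have : \sum_(0 <= x < 2 * N) \sum_(0 <= i < M) (A (x + i * d)%N)%:R = M%:R * S.
    rewrite exchange_big_nat /= (eq_big_nat _ _ (F2 := fun=> S)).
      by rewrite sumr_const_nat subn0 mulr_natl.
    move=> i /andP[_ iM]; apply: (@sum_shift_support _ (fun z => (A z)%:R)).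
      by apply: leq_trans DM; rewrite mulnC leq_mul // ltnW.
    by move=> z; apply: contraNeq; case Az: (A z); rewrite ?eqxx // => _; apply: supp.
  have : \sum_(0 <= x < 2 * N) \sum_(0 <= i < M) (A (x + i * d)%N)%:R <=
      \sum_(0 <= x < 2 * N) (delta / 4 * M%:R + M%:R * G d x).
    by apply: sum_le_nat => x _; apply: Pd.
  rewrite big_split /= -(mulr_sumr _ _ _ M%:R) sumr_const_nat subn0 -[_ *+ (2 * N)]mulr_natr natrM.
  move=> h1 h2; rewrite -(ler_pM2l Mr0).
  have : M%:R * (delta * N%:R) <= M%:R * S by rewrite ler_wpM2l.
  by lra.
have upper : \sum_(1 <= d < D.+1) \sum_(0 <= x < 2 * N) G d x <= M%:R ^+ 2 * T.
  rewrite /G.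
  under eq_bigr => d _ do rewrite exchange_big_nat.
  rewrite exchange_big_nat /=.
  have -> : M%:R ^+ 2 * T = \sum_(0 <= i < M) (M%:R * T).
    by rewrite sumr_const_nat subn0 -[RHS]mulr_natl mulrA.
  apply: sum_le_nat => i /andP[_ iM].
  under eq_bigr => d _ do rewrite exchange_big_nat.
  rewrite exchange_big_nat /=.
  have T0 : 0 <= T by rewrite sumr_ge0 // => n _; rewrite sumr_ge0.
  apply: le_trans (_ : \sum_(1 <= e < M) T <= _); last first.
    by rewrite sumr_const_nat -[leLHS]mulr_natl ler_wpM2r // ler_nat leq_subr.
  apply: sum_le_nat => e /andP[e1 eM].
  apply: le_trans (@sum_multiples_le R
    (fun n => \sum_(0 <= t < 2 * N) (ap3_at A t n)%:R) D e N _ e1 _).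
  - apply: sum_le_nat => d /andP[d1 dD].
    rewrite -(@sum_shift_support _ (fun t => (ap3_at A t (d * e))%:R) N (i * d)%N) //.
      by apply: leq_trans DM; rewrite mulnC leq_mul // ltnW.
    move=> z; apply: contraNeq; rewrite /ap3_at; case Az: (A z); last by rewrite eqxx.
    by move=> _; apply: supp.
  - by move=> n; rewrite sumr_ge0.
  - apply: leq_trans DM; rewrite ltn_mul2l eM andbT.
    by rewrite divn_gt0.
have lower : D%:R * (delta / 2 * N%:R) <= M%:R ^+ 2 * T.
  apply: le_trans upper.
  have -> : D%:R * (delta / 2 * N%:R) = \sum_(1 <= d < D.+1) (delta / 2 * N%:R).
    by rewrite sumr_const_nat subn1 /= -[RHS]mulr_natl.
  by apply: sum_le_nat => d Hd; apply: sumG.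
have ND : N%:R <= 2 * D%:R * M%:R :> R by rewrite -!natrM ler_nat.
rewrite -(@ler_pM2l _ (M%:R ^+ 2)) ?exprn_gt0 //; apply: le_trans lower.
have -> : M%:R ^+ 2 * (delta / (4 * M%:R ^+ 3) * N%:R ^+ 2) =
  (delta / 2 * N%:R / (2 * M%:R)) * N%:R.
  by field; rewrite gt_eqF.
have -> : D%:R * (delta / 2 * N%:R) = (delta / 2 * N%:R / (2 * M%:R)) * (2 * D%:R * M%:R).
  by field; rewrite gt_eqF.
by rewrite ler_wpM2l // !mulr_ge0 ?invr_ge0 ?mulr_ge0 // ltW.
Qed.

(** * Fourier analysis on a grid of frequencies *)

Lemma sum_nat_only (V : nmodType) (F : nat -> V) L k : (k < L)%N ->
  (forall i, i != k -> F i = 0) -> \sum_(0 <= i < L) F i = F k.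
Proof.
move=> kL F0; rewrite big_mkord (bigD1 (Ordinal kL)) //= big1 ?addr0 // => i.
by rewrite -val_eqE => /F0.
Qed.

Section Fourier.
Variable R : realType.
Implicit Types (G W H : nat -> R) (M : nat).

(** Real and imaginary parts of the character [e(xi k / M)]; working with the pair avoids complex
    numbers. *)
Definition cos_coef M (xi k : nat) : R := cos (2 * pi / M%:R * xi%:R * k%:R).
Definition sin_coef M (xi k : nat) : R := sin (2 * pi / M%:R * xi%:R * k%:R).

(** Multiplication by [2 sin (th / 2)], nonzero since [0 < th / 2 < pi], makes the sum telescope,
    and the end terms agree by periodicity. *)
Lemma sum_cos_roots M j : (0 < j < M)%N ->
  \sum_(0 <= xi < M) cos (2 * pi / M%:R * xi%:R * j%:R) = 0 :> R.
Proof.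
case/andP => j0 jM; have M0 : (0 < M)%N by lia.
have Mr : 0 < M%:R :> R by rewrite ltr0n.
pose th : R := 2 * pi / M%:R * j%:R.
pose g xi : R := sin (xi%:R * th - th / 2).
have s0 : 0 < sin (th / 2).
  have -> : th / 2 = pi * (j%:R / M%:R) by rewrite /th; field; rewrite gt_eqF.
  apply: sin_gt0_pi; rewrite mulr_gt0 ?pi_gt0 ?divr_gt0 ?ltr0n //=.
  by rewrite gtr_pMr ?pi_gt0 // ltr_pdivrMr // mul1r ltr_nat.
have tele : 2 * sin (th / 2) * (\sum_(0 <= xi < M) cos (xi%:R * th)) = g M - g 0%N.
  rewrite -telescope_sumr // mulr_sumr; apply: eq_big_nat => xi _.
  have -> : g xi.+1 = sin (xi%:R * th + th / 2) by rewrite /g -natr1; congr sin; field.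
  by rewrite /g sinD sinB; ring.
have gM : g M = g 0%N.
  rewrite /g mul0r add0r.
  have -> : M%:R * th - th / 2 = - (th / 2) + (pi *+ 2) *+ j.
    by rewrite /th -[(pi *+ 2) *+ j]mulr_natr -[pi *+ 2]mulr_natr; field; rewrite gt_eqF.
  by rewrite (periodicn (@sinD2pi R)).
move: tele; rewrite gM subrr => /eqP; rewrite mulf_eq0 [_ * sin _ == 0]gt_eqF /=; last by rewrite mulr_gt0.
by move/eqP => E; rewrite -[RHS]E; apply: eq_bigr => xi _; congr cos; rewrite /th; ring.
Qed.

Lemma cos_coef_orthogonality M a b : (a < M)%N -> (b < M)%N ->
  \sum_(0 <= xi < M) cos (2 * pi / M%:R * xi%:R * a%:R - 2 * pi / M%:R * xi%:R * b%:R)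
  = (M%:R * (a == b)%:R : R).
Proof.
wlog ba : a b / (b <= a)%N.
  move=> Hw aM bM; case: (leqP b a) => [/Hw|/ltnW ab]; first exact.
  rewrite eq_sym; apply: etrans (Hw b a ab bM aM); apply: eq_bigr => xi _.
  by rewrite -[LHS]cosN opprB.
move=> aM bM; case: (eqVneq a b) => [->|ab].
  transitivity (\sum_(0 <= xi < M) (1 : R)); last by rewrite sumr_const_nat subn0 mulr1.
  by apply: eq_bigr => xi _; rewrite subrr cos0.
have abM : (0 < a - b < M)%N by lia.
rewrite mulr0 -[RHS](@sum_cos_roots M _ abM).
by apply: eq_bigr => xi _; rewrite natrB // mulrBr.
Qed.

Lemma sum_cosB (L : nat) (u c : nat -> R) x :
  \sum_(0 <= s < L) u s * cos (x - c s) =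
  cos x * (\sum_(0 <= s < L) u s * cos (c s)) + sin x * (\sum_(0 <= s < L) u s * sin (c s)).
Proof.
rewrite !mulr_sumr -big_split; apply: eq_bigr => s _ /=.
by rewrite cosB; ring.
Qed.

Lemma parseval M (L : nat) G : (L <= M)%N ->
  \sum_(0 <= xi < M) ((\sum_(0 <= k < L) G k * cos_coef M xi k) ^+ 2
     + (\sum_(0 <= k < L) G k * sin_coef M xi k) ^+ 2)
  = M%:R * \sum_(0 <= k < L) G k ^+ 2.
Proof.
move=> LM; transitivity (\sum_(0 <= k < L) \sum_(0 <= k' < L) \sum_(0 <= xi < M)
   G k * (G k' * cos (2 * pi / M%:R * xi%:R * k%:R - 2 * pi / M%:R * xi%:R * k'%:R))).
  under [RHS]eq_bigr => k _ do rewrite exchange_big_nat /=.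
  rewrite [RHS]exchange_big_nat /=; apply: eq_bigr => xi _.
  under [RHS]eq_bigr => k _ do rewrite -mulr_sumr sum_cosB.
  rewrite !expr2 {1}mulr_suml {1}mulr_suml -big_split /=; apply: eq_bigr => k _.
  by rewrite /cos_coef /sin_coef; ring.
rewrite mulr_sumr; apply: eq_big_nat => k /andP[_ kL].
under eq_big_nat => k' /andP[_ k'L].
  rewrite -mulr_sumr -mulr_sumr cos_coef_orthogonality ?(leq_trans kL) ?(leq_trans k'L) //.
  over.
rewrite (@sum_nat_only _ _ L k) //; first by rewrite eqxx mulr1; ring.
by move=> k' /negbTE; rewrite eq_sym => ->; rewrite !mulr0.
Qed.

(** [L + N <= M] excludes wrap-around, so [H (k + n)] can be expanded in the characters of the grid.
    Then [W] enters only through its transform, bounded by [tau], and Parseval treats [G] and [H].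
    Its use with [L = 2N] is the reason for a grid of [3N] points. *)
Lemma convolution_bound M N L G W H (tau : R) : (0 < M)%N -> (L + N <= M)%N ->
  (forall s, (L <= s)%N -> H s = 0) ->
  (forall xi, (xi < M)%N -> `|\sum_(0 <= n < N) W n * cos_coef M xi n| <= tau) ->
  (forall xi, (xi < M)%N -> `|\sum_(0 <= n < N) W n * sin_coef M xi n| <= tau) ->
  \sum_(0 <= k < L) G k * (\sum_(0 <= n < N) W n * H (k + n)%N) <=
  tau * (\sum_(0 <= k < L) G k ^+ 2 + \sum_(0 <= k < L) H k ^+ 2).
Proof.
move=> M0 LNM suppH Wc Ws.
have Mr : 0 < M%:R :> R by rewrite ltr0n.
rewrite -(ler_pM2l Mr) mulrCA [in leRHS]mulrDr -!parseval ?(leq_trans (leq_addr _ _) LNM) //.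
rewrite -big_split [leRHS]mulr_sumr /=.
have -> : M%:R * (\sum_(0 <= k < L) G k * (\sum_(0 <= n < N) W n * H (k + n)%N)) =
  \sum_(0 <= xi < M) \sum_(0 <= k < L) G k * (\sum_(0 <= n < N) W n *
    \sum_(0 <= s < L) H s *
    cos (2 * pi / M%:R * xi%:R * (k + n)%:R - 2 * pi / M%:R * xi%:R * s%:R)).
  rewrite exchange_big_nat /= mulr_sumr; apply: eq_big_nat => k /andP[_ kL].
  rewrite -mulr_sumr mulrCA; congr (_ * _).
  rewrite exchange_big_nat /= mulr_sumr; apply: eq_big_nat => n /andP[_ nN].
  rewrite -mulr_sumr mulrCA; congr (_ * _).
  rewrite exchange_big_nat /=.
  under eq_big_nat => s /andP[_ sL].
    rewrite -mulr_sumr cos_coef_orthogonality; [|lia..].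
    over.
  case: (ltnP (k + n) L) => knL; last first.
    rewrite suppH // mulr0 big_nat_cond big1 // => s /andP[/andP[_ sL] _].
    by rewrite gtn_eqF ?mulr0 //; apply: leq_trans knL.
  rewrite (@sum_nat_only _ _ L (k + n)%N) //; first by rewrite eqxx mulr1; ring.
  by move=> s /negbTE; rewrite eq_sym => ->; rewrite !mulr0.
apply: sum_le_nat => xi /andP[_ xiM].
have := Wc xi xiM; have := Ws xi xiM.
set wc := \sum_(0 <= n < N) W n * cos_coef M xi n.
set ws := \sum_(0 <= n < N) W n * sin_coef M xi n.
set gc := \sum_(0 <= n < L) G n * cos_coef M xi n.
set gs := \sum_(0 <= n < L) G n * sin_coef M xi n.
set hc := \sum_(0 <= n < L) H n * cos_coef M xi n.
set hs := \sum_(0 <= n < L) H n * sin_coef M xi n.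
move=> lews lewc.
have -> : \sum_(0 <= k < L) G k * (\sum_(0 <= n < N) W n *
    \sum_(0 <= s < L) H s *
    cos (2 * pi / M%:R * xi%:R * (k + n)%:R - 2 * pi / M%:R * xi%:R * s%:R))
  = (gc * wc - gs * ws) * hc + (gs * wc + gc * ws) * hs.
  transitivity (\sum_(0 <= k < L) (G k * cos_coef M xi k * (wc * hc + ws * hs)
     + G k * sin_coef M xi k * (wc * hs - ws * hc))).
    apply: eq_bigr => k _.
    transitivity (G k * (\sum_(0 <= n < N) (W n * cos_coef M xi n *
         (cos_coef M xi k * hc + sin_coef M xi k * hs) + W n * sin_coef M xi n *
         (cos_coef M xi k * hs - sin_coef M xi k * hc)))).
      congr (_ * _); apply: eq_bigr => n _.
      by rewrite sum_cosB -/hc -/hs (natrD R k n) (mulrDr (2 * pi / M%:R * xi%:R)) cosD sinD /cos_coef /sin_coef; ring.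
    by rewrite big_split /= -!mulr_suml -/wc -/ws; ring.
  by rewrite big_split /= -!mulr_suml -/gc -/gs; ring.
have tau0 : 0 <= tau by apply: le_trans lewc.
apply: le_trans (_ : tau * ((`|gc| + `|gs|) * (`|hc| + `|hs|)) <= _); last first.
  rewrite ler_wpM2l // -[gc ^+ 2]real_normK ?num_real // -[gs ^+ 2]real_normK ?num_real //.
  rewrite -[hc ^+ 2]real_normK ?num_real // -[hs ^+ 2]real_normK ?num_real //.
  move: `|gc| `|gs| `|hc| `|hs| => a b c d.
  have := sqr_ge0 (a + b - c - d); have := sqr_ge0 (a - b); have := sqr_ge0 (c - d).
  by rewrite !expr2; nra.
apply: le_trans (ler_norm _) _.
apply: le_trans (_ : `|gc| * `|wc| * `|hc| + `|gs| * `|ws| * `|hc|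
  + `|gs| * `|wc| * `|hs| + `|gc| * `|ws| * `|hs| <= _).
  rewrite -!normrM -addrA; apply: le_trans (ler_normD _ _) _; rewrite lerD //.
    by rewrite mulrBl; apply: le_trans (ler_normB _ _) _.
  by rewrite mulrDl; apply: le_trans (ler_normD _ _) _.
have bnd (x y z : R) : `|y| <= tau -> `|x| * `|y| * `|z| <= tau * (`|x| * `|z| : R).
  by move=> yt; rewrite (mulrC `|x|) -mulrA ler_wpM2r ?mulr_ge0.
have := bnd gc wc hc lewc; have := bnd gs ws hc lews.
have := bnd gs wc hs lewc; have := bnd gc ws hs lews.
lra.
Qed.
End Fourier.

(** * The generalized von Neumann inequality *)

Lemma sqr_sum_mul_le (R : realFieldType) (N : nat) (a u : nat -> R) :
  (\sum_(0 <= t < N) a t * u t) ^+ 2 <=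
  (\sum_(0 <= t < N) a t ^+ 2) * (\sum_(0 <= t < N) u t ^+ 2).
Proof.
set P := \sum_(0 <= t < N) a t * u t.
set Q := \sum_(0 <= t < N) a t ^+ 2; set S := \sum_(0 <= t < N) u t ^+ 2.
have Q0 : 0 <= Q by rewrite sumr_ge0 // => i _; rewrite sqr_ge0.
have key x y : 0 <= x ^+ 2 * Q - 2 * x * y * P + y ^+ 2 * S.
  rewrite /Q /P /S !mulr_sumr -sumrB -big_split /=; apply: sumr_ge0 => t _.
  by rewrite (_ : _ + _ = (x * a t - y * u t) ^+ 2) ?sqr_ge0 //; ring.
have [Qp|Qn] := ltP 0 Q.
  have := key P Q.
  rewrite (_ : _ + _ = Q * (Q * S - P ^+ 2)); last by ring.
  by rewrite pmulr_rge0 // subr_ge0.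
have Qz : Q = 0 by apply/eqP; rewrite eq_le Qn Q0.
case: (eqVneq P 0) => [->|P0]; first by rewrite expr0n Qz mul0r.
(* For [Q = 0] the form is affine in [x]; this choice gives it the value [-1]. *)
have := key ((S + 1) / (2 * P)) 1.
by rewrite Qz (_ : _ + _ = -1) ?ler0N1 //; field.
Qed.

(* A lies in [N, 2N) rather than in [0, N) so that the substitution k = t + n
   after Cauchy-Schwarz, with n < N, never leaves the range t >= 0. *)
Lemma von_neumann_ap3 (R : realType) (N : nat) (A : pred nat) (w : nat -> R) (tau : R) :
  0 <= tau ->
  (forall i, A i -> (N <= i < 2 * N)%N) ->
  (forall n, `|w n| <= 1) -> (forall n, (N <= n)%N -> w n = 0) ->
  (forall r xi, (0 < r < N)%N -> (xi < 3 * N)%N ->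
    `|\sum_(0 <= n < N) w n * w (n + r)%N * cos_coef R (3 * N) xi n| <= tau /\
    `|\sum_(0 <= n < N) w n * w (n + r)%N * sin_coef R (3 * N) xi n| <= tau) ->
  (\sum_(0 <= n < N) w n * \sum_(0 <= t < 2 * N) (ap3_at A t n)%:R) ^+ 2
  <= N%:R ^+ 3 * (2 + 4 * tau).
Proof.
move=> tau0 supp w1 w0 small.
case: (posnP N) => [->|N0]; first by rewrite big_geq // !expr0n /= mul0r.
pose a i : R := (A i)%:R.
have a01 i : 0 <= a i <= 1 by rewrite /a; case: (A i); rewrite ?lexx ?ler01.
have a0 i : ~~ (N <= i < 2 * N)%N -> a i = 0.
  by rewrite /a; case Ai: (A i) => //; rewrite supp.
pose v t n : R := w n * (a (t + n)%N * a (t + 2 * n)%N).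
have -> : \sum_(0 <= n < N) w n * \sum_(0 <= t < 2 * N) (ap3_at A t n)%:R =
    \sum_(0 <= t < 2 * N) a t * (\sum_(0 <= n < N) v t n).
  under eq_bigr => n _ do rewrite mulr_sumr.
  rewrite exchange_big_nat /=; apply: eq_bigr => t _; rewrite mulr_sumr.
  apply: eq_bigr => n _; rewrite /v /a /ap3_at.
  by case: (A t); case: (A _); case: (A _); rewrite /= ?mulr1n ?mulr0n; ring.
apply: le_trans (sqr_sum_mul_le _ _ _ _) _.
have suma : \sum_(0 <= t < 2 * N) a t ^+ 2 <= N%:R.
  rewrite (@big_cat_nat _ _ _ N 0%N (2 * N)%N) //=; last by lia.
  rewrite big_nat_cond big1 ?add0r; last first.
    by move=> i /andP[/andP[_ iN] _]; rewrite a0 ?expr0n // negb_and -ltnNge iN.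
  have -> : N%:R = \sum_(N <= i < 2 * N) (1 : R) by rewrite sumr_const_nat mul2n -addnn addnK.
  by apply: sum_le_nat => i _; have /andP[? ?] := a01 i; rewrite expr_le1.
have sumv : \sum_(0 <= t < 2 * N) (\sum_(0 <= n < N) v t n) ^+ 2 <= N%:R ^+ 2 * (2 + 4 * tau).
  under eq_bigr => t _ do rewrite sqr_sum_nat.
  rewrite big_split /= -mulr_sumr.
  have diag : \sum_(0 <= t < 2 * N) \sum_(0 <= n < N) v t n ^+ 2 <= 2 * N%:R ^+ 2.
    have -> : 2 * N%:R ^+ 2 = \sum_(0 <= t < 2 * N) \sum_(0 <= n < N) (1 : R).
      by rewrite !sumr_const_nat !subn0 -[RHS]mulr_natr natrM; ring.
    apply: sum_le_nat => t _; apply: sum_le_nat => n _.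
    rewrite -[v t n ^+ 2]real_normK ?num_real // expr_le1 // /v !normrM.
    have /andP[? ?] := a01 (t + n)%N; have /andP[? ?] := a01 (t + 2 * n)%N.
    by rewrite !mulr_ile1 ?mulr_ge0 // ger0_norm.
  have off : \sum_(0 <= t < 2 * N) \sum_(1 <= r < N) \sum_(0 <= n < N - r)
      v t n * v t (n + r)%N <= N%:R * (2 * N%:R * tau).
    rewrite exchange_big_nat /=.
    apply: le_trans (_ : \sum_(1 <= r < N) (2 * N%:R * tau) <= _); last first.
      rewrite sumr_const_nat -[leLHS]mulr_natl.
      by rewrite ler_wpM2r ?ler_nat ?leq_subr // !mulr_ge0.
    apply: sum_le_nat => r /andP[r1 rN].
    (* With [k = t + n] the product [v t n * v t (n + r)] separates into [G k], [W n] and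
       [H (k + n)]: a convolution in which [A] enters only through [G] and [H]. *)
    pose G k : R := a k * a (k + r)%N.
    pose H k : R := a k * a (k + 2 * r)%N.
    pose W n : R := w n * w (n + r)%N.
    have GH r' : \sum_(0 <= k < 2 * N) (a k * a (k + r')%N) ^+ 2 <= N%:R.
      apply: le_trans suma; apply: sum_le_nat => k _.
      rewrite exprMn ler_piMr ?sqr_ge0 //.
      by have /andP[? ?] := a01 (k + r')%N; rewrite expr_le1.
    have -> : \sum_(0 <= t < 2 * N) \sum_(0 <= n < N - r) v t n * v t (n + r)%N =
        \sum_(0 <= k < 2 * N) G k * (\sum_(0 <= n < N) W n * H (k + n)%N).
      rewrite exchange_big_nat /=.
      under [RHS]eq_bigr => k _ do rewrite mulr_sumr.
      rewrite [RHS]exchange_big_nat /=.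
      rewrite [RHS](@big_cat_nat _ _ _ (N - r)%N) //= ?leq_subr //.
      rewrite [X in _ + X]big_nat_cond [X in _ + X]big1 ?addr0; last first.
        move=> n /andP[/andP[nr _] _]; rewrite big1 // => k _.
        by rewrite /W (w0 (n + r)%N) ?mulr0 ?mul0r ?mulr0 //; lia.
      apply: eq_big_nat => n /andP[_ nN].
      rewrite -(@sum_shift_support _ (fun k => G k * (W n * H (k + n)%N)) N n) //; try lia.
        apply: eq_bigr => t _; rewrite /G /H /W /v.
        have -> : (t + n + r = t + (n + r))%N by lia.
        have -> : (t + n + n = t + 2 * n)%N by lia.
        have -> : (t + 2 * (n + r) = t + 2 * n + 2 * r)%N by lia.
        by ring.
      by move=> z /a0 E; rewrite /G E !mul0r.
    have M0 : (0 < 3 * N)%N by lia.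
    have LNM : (2 * N + N <= 3 * N)%N by lia.
    have Hs s : (2 * N <= s)%N -> H s = 0.
      by move=> sN; rewrite /H a0 ?mul0r // negb_and -!ltnNge; lia.
    have rN' : (0 < r < N)%N by rewrite r1.
    apply: le_trans (@convolution_bound R (3 * N) N (2 * N) G W H tau M0 LNM Hs _ _) _.
    - by move=> xi Hxi; have [] := small r xi rN' Hxi.
    - by move=> xi Hxi; have [] := small r xi rN' Hxi.
    - rewrite mulrC ler_wpM2r // mulr_natl mulr2n lerD ?GH //.
  have -> : N%:R ^+ 2 * (2 + 4 * tau) = 2 * N%:R ^+ 2 + 2 * (N%:R * (2 * N%:R * tau)) by ring.
  by rewrite lerD // ler_wpM2l.
have -> : N%:R ^+ 3 * (2 + 4 * tau) = N%:R * (N%:R ^+ 2 * (2 + 4 * tau)) by ring.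
apply: ler_pM => //; last by rewrite sumr_ge0 // => t _; rewrite sqr_ge0.
by rewrite sumr_ge0 // => t _; rewrite sqr_ge0.
Qed.

(** A boolean over finite index types, so that its failure is an event on the finite space of digit
    strings. The shift 0 is the diagonal of Cauchy-Schwarz, bounded separately. *)
Definition pseudorandom (R : realType) (N : nat) (w : nat -> R) (tau : R) : bool :=
  [forall r : 'I_N, forall xi : 'I_(3 * N), (0 < r)%N ==>
    (`|\sum_(0 <= n < N) w n * w (n + r)%N * cos_coef R (3 * N) xi n| <= tau) &&
    (`|\sum_(0 <= n < N) w n * w (n + r)%N * sin_coef R (3 * N) xi n| <= tau)].

(** The value 0 at [n = 0] discards degenerate progressions; the value 0 from [N] on cuts off the
    correlations at [n + r >= N]. *)
Definition centered (R : realType) (N : nat) (p : R) (X : pred nat) (n : nat) : R :=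
  if (0 < n < N)%N then (X n)%:R - p else 0.

(** If no progression has its difference in [X], then [w n = - p] wherever one occurs, and the
    weighted count is [- p] times the full count. By [varnavides] it is then too large for the von
    Neumann inequality. *)
Theorem pseudorandom_difference (R : realType) (delta : R) : 0 < delta ->
  exists (c : R) N0, 0 < c /\ forall N (A X : pred nat) (p tau : R), (N0 <= N)%N ->
    (forall i, A i -> (N <= i < 2 * N)%N) ->
    delta * N%:R <= \sum_(0 <= i < 2 * N) (A i)%:R ->
    0 <= p <= 1 -> 0 <= tau -> pseudorandom R N (centered R N p X) tau ->
    N%:R ^+ 3 * (2 + 4 * tau) < (c * p * N%:R ^+ 2) ^+ 2 ->
    exists t n, [/\ (0 < n < N)%N, X n & ap3_at A t n].
Proof.
move=> d0; have [c [N0 [c0 count]]] := @varnavides R delta d0.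
exists c, N0; split => // N A X p tau NN0 supp HA /andP[p0 p1] tau0 /forallP pr small.
case: (pselect (exists t n, [/\ (0 < n < N)%N, X n & ap3_at A t n])) => // none.
exfalso; move: small; apply/negP; rewrite -leNgt.
pose w := centered R N p X.
have w1 n : `|w n| <= 1.
  rewrite /w /centered; case: ifP => _; last by rewrite normr0.
  by rewrite ler_norml; case: (X n); rewrite /=; lra.
have w0 n : (N <= n)%N -> w n = 0.
  by move=> nN; rewrite /w /centered [(n < N)%N]ltnNge nN andbF.
have vn := @von_neumann_ap3 R N A w tau tau0 supp w1 w0.
apply: le_trans (vn _); last first.
  move=> r xi /andP[r0 rN] xiN.
  by have /forallP/(_ (Ordinal xiN)) := pr (Ordinal rN); rewrite /= r0 => /andP[].
pose T n : R := \sum_(0 <= t < 2 * N) (ap3_at A t n)%:R.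
have -> : \sum_(0 <= n < N) w n * \sum_(0 <= t < 2 * N) (ap3_at A t n)%:R =
    - (p * \sum_(1 <= n < N) T n).
  case: N {vn pr NN0 HA supp} @w @T w1 w0 none => [|N] w T w1 w0 none.
    by rewrite !big_geq // mulr0 oppr0.
  rewrite big_ltn // {1}/w /centered /= mul0r add0r mulr_sumr -sumrN.
  apply: eq_big_nat => n /andP[n0 nN]; rewrite /w /centered n0 nN /=.
  case Xn: (X n); last by rewrite sub0r mulNr.
  rewrite /T big1 ?mulr0 ?oppr0 // => t _.
  by case ap: (ap3_at A t n) => //; exfalso; apply: none; exists t, n; rewrite n0 nN.
rewrite sqrrN lerXn2r ?nnegrE ?mulr_ge0 ?exprn_ge0 ?(ltW c0) //.
  by rewrite sumr_ge0 // => n _; rewrite sumr_ge0.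
rewrite mulrAC [leLHS]mulrC ler_wpM2l //; exact: count.
Qed.

(** * Independence on finite product spaces *)

Section Average.
Variables (R : realType) (I J : finType) (j0 : J).
Local Notation Omega := {ffun I -> J}.
Implicit Types (F G : Omega -> R) (S : {set I}).

Definition average F : R := (\sum_f F f) / #|Omega|%:R.

Definition depends_on S F : Prop :=
  forall f g : Omega, (forall i, i \in S -> f i = g i) -> F f = F g.

Lemma card_ffun_gt0 : 0 < #|Omega|%:R :> R.
Proof. by rewrite ltr0n; apply/card_gt0P; exists [ffun=> j0]. Qed.

Lemma average_le F G : (forall f, F f <= G f) -> average F <= average G.
Proof. by move=> H; rewrite ler_wpM2r ?invr_ge0 // ler_sum. Qed.

Lemma averageD F G : average (fun f => F f + G f) = average F + average G.
Proof. by rewrite /average big_split mulrDl. Qed.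

Lemma averageZ c F : average (fun f => c * F f) = c * average F.
Proof. by rewrite /average -mulr_sumr mulrA. Qed.

Lemma average_cst c : average (fun=> c) = c.
Proof.
rewrite /average sumr_const -[c *+ _]mulr_natr mulfK // gt_eqF //; exact: card_ffun_gt0.
Qed.

Lemma average_ge0 F : (forall f, 0 <= F f) -> 0 <= average F.
Proof. by move=> H; rewrite divr_ge0 // sumr_ge0. Qed.

Lemma average_sum (F : nat -> Omega -> R) (s : seq nat) :
  average (fun f => \sum_(k <- s) F k f) = \sum_(k <- s) average (F k).
Proof. by rewrite /average exchange_big mulr_suml. Qed.

(* The involution of pairs exchanging the coordinates outside S turns
   [F f * G g] into [F f * G f]. *)
Lemma average_mul S F G : depends_on S F -> depends_on (~: S)%SET G ->
  average (fun f => F f * G f) = average F * average G.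
Proof.
move=> dF dG.
pose mix (f g : Omega) : Omega := [ffun i => if i \in S then f i else g i].
pose sw (u : Omega * Omega) := (mix u.1 u.2, mix u.2 u.1).
have swK : involutive sw.
  by move=> [f g]; rewrite /sw /=; congr (_, _); apply/ffunP => i; rewrite !ffunE; case: (i \in S).
have E : (\sum_f F f) * (\sum_g G g) = #|Omega|%:R * \sum_f F f * G f.
  transitivity (\sum_(u : Omega * Omega) F u.1 * G u.2).
    by rewrite -(pair_bigA _ (fun f g => F f * G g)) /= big_distrlr.
  rewrite [LHS](reindex_inj (inv_inj swK)) /=.
  transitivity (\sum_(u : Omega * Omega) F u.1 * G u.1).
    apply: eq_bigr => -[f g] _ /=; congr (_ * _).
      by apply: dF => i iS; rewrite ffunE iS.
    by apply: dG => i; rewrite inE => /negbTE iS; rewrite ffunE iS.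
  rewrite -(pair_bigA _ (fun f g => F f * G f)) /=.
  rewrite mulr_sumr; apply: eq_bigr => f _; rewrite sumr_const.
  by rewrite mulr_natl.
rewrite /average mulf_div E -mulf_div divff ?mul1r //.
by rewrite gt_eqF // card_ffun_gt0.
Qed.

Lemma average_prod (s : seq nat) (D : nat -> {set I}) (F : nat -> Omega -> R) :
  uniq s -> (forall k, depends_on (D k) (F k)) ->
  {in s &, forall k k', k != k' -> [disjoint D k & D k']} ->
  average (fun f => \prod_(k <- s) F k f) = \prod_(k <- s) average (F k).
Proof.
move=> us dF; elim: s us => [|k s IH] /=.
  by move=> _ _; rewrite big_nil (_ : (fun _ => _) = fun=> 1) ?average_cst //;
     apply/funext => f; rewrite big_nil.
case/andP=> ks us disj; rewrite big_cons -IH //; last first.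
  by move=> i j is_ js; apply: disj; rewrite inE ?is_ ?js orbT.
rewrite -(average_mul (D k) (F k)) //.
  by congr average; apply/funext => f; rewrite big_cons.
move=> f g fg; apply: eq_big_seq => k' k's; apply: dF => i iD; apply: fg.
rewrite inE; apply/negP => iDk.
have /disj : k \in k :: s by rewrite inE eqxx.
move=> /(_ k'); rewrite inE k's orbT => /(_ isT).
have -> : k != k' by apply: contraNneq ks => ->.
by move=> /(_ isT)/pred0P/(_ i) /=; rewrite iD iDk.
Qed.

Lemma average_coord (i : I) (phi : J -> R) :
  average (fun f => phi (f i)) = (\sum_j phi j) / #|J|%:R.
Proof.
have J0 : #|J|%:R != 0 :> R by rewrite pnatr_eq0 -lt0n; apply/card_gt0P; exists j0.
rewrite /average.
(* All factors but one are trivial; in this form the sum over [f] distributes over the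
   coordinates. *)
have -> : \sum_(f : Omega) phi (f i) =
    \sum_(f : Omega) \prod_k (if k == i then phi (f k) else 1).
  by apply: eq_bigr => f _; rewrite -big_mkcond big_pred1_eq.
rewrite -(bigA_distr_bigA (fun k j => if k == i then phi j else 1)) /=.
rewrite (bigD1 i) //= eqxx card_ffun.
rewrite [X in _ * X / _](eq_bigr (fun=> #|J|%:R)); last first.
  by move=> k /negbTE ->; rewrite sumr_const.
rewrite prodr_const (_ : #|_| = #|I|.-1); last first.
  by rewrite cardC1.
have : (0 < #|I|)%N by apply/card_gt0P; exists i.
case: #|I| => // m _ /=; rewrite expnS natrM natrX.
by rewrite -mulf_div divff ?mulr1 // expf_neq0.
Qed.
End Average.

(** * Large deviations for random digits *)

Lemma expR_le_quadratic (R : realType) (x : R) : `|x| <= 1 / 2 -> expR x <= 1 + x + 2 * x ^+ 2.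
Proof.
move=> /[!ler_norml] /andP[x1 x2].
have := expR_ge1Dx (- x); rewrite expRN => H.
have e0 := expR_gt0 x.
have : expR x * (1 - x) <= 1 by rewrite -ler_pdivlMl // mulr1.
have : 1 <= (1 - x) * (1 + x + 2 * x ^+ 2).
  have -> : (1 - x) * (1 + x + 2 * x ^+ 2) = 1 + x ^+ 2 * (1 - 2 * x) by ring.
  by rewrite lerDl mulr_ge0 ?sqr_ge0 //; lra.
move=> h1 h2; have x3 : 0 < 1 - x by lra.
by rewrite -(ler_pM2l x3) (le_trans _ h1) // mulrC.
Qed.

Section RandomDigits.
Variables (R : realType) (N B : nat) (B_gt0 : (0 < B)%N).
Local Notation Omega := {ffun 'I_N -> 'I_B}.
Local Notation avg := (@average R 'I_N 'I_B).
Let j0 : 'I_B := Ordinal B_gt0.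
Let p : R := B%:R^-1.

Definition zero_digit (f : Omega) : pred nat :=
  fun n => if insub n is Some i then val (f i) == 0%N else false.

Definition wdigit (n : nat) (f : Omega) : R := centered R N p (zero_digit f) n.

Let p_ge0 : 0 <= p. Proof. by rewrite invr_ge0. Qed.
Let p_le1 : p <= 1. Proof. by rewrite invf_le1 ?ler1n ?ltr0n. Qed.

Lemma wdigit_norm n f : `|wdigit n f| <= 1.
Proof.
have := p_ge0; have := p_le1; rewrite /wdigit /centered; case: ifP => _ ? ?; last by rewrite normr0.
by rewrite ler_norml; case: (zero_digit f n); rewrite /=; lra.
Qed.

Lemma wdigit_coord n (nN : (n < N)%N) : (0 < n)%N ->
  wdigit n = fun f => (f (Ordinal nN) == j0)%:R - p.
Proof.
move=> n0; apply/funext => f; rewrite /wdigit /centered n0 nN /zero_digit.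
by rewrite insubT /= -val_eqE.
Qed.

Lemma wdigit_depends n : depends_on R _ _ [set i | val i == n]%SET (wdigit n).
Proof.
move=> f g fg; rewrite /wdigit /centered /zero_digit; case: ifP => // /andP[_ nN].
by rewrite insubT fg // inE.
Qed.

Lemma average_coord_eq (i : 'I_N) (u v : R) :
  avg (fun f => if f i == j0 then u else v) = p * u + (1 - p) * v.
Proof.
have Br : B%:R != 0 :> R by rewrite pnatr_eq0 -lt0n.
rewrite (@average_coord R _ _ j0 i (fun j => if j == j0 then u else v)) card_ord.
rewrite (bigD1 j0) //= (eq_bigr (fun=> v)); last by move=> j /negbTE ->.
rewrite sumr_const cardC1 card_ord -[v *+ _]mulr_natr -subn1 natrB // /p.
by field.
Qed.

Lemma average_wdigit n : avg (wdigit n) = 0.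
Proof.
case: (boolP (0 < n < N)%N) => [/andP[n0 nN]|nn]; last first.
  rewrite (_ : wdigit n = fun=> 0) ?(average_cst _ _ _ j0) //.
  by apply/funext => f; rewrite /wdigit /centered (negbTE nn).
rewrite (wdigit_coord n nN n0).
have := average_coord_eq (Ordinal nN) (1 - p) (- p).
rewrite (_ : (fun f : Omega => _) = fun f => (f (Ordinal nN) == j0)%:R - p).
  by move=> ->; ring.
by apply/funext => f; case: eqP => _; rewrite ?sub0r.
Qed.

Lemma average_wdigit_sqr n : avg (fun f => wdigit n f ^+ 2) <= p.
Proof.
case: (boolP (0 < n < N)%N) => [/andP[n0 nN]|nn]; last first.
  rewrite (_ : (fun f => _) = fun=> 0) ?(average_cst _ _ _ j0) ?p_ge0 //.
  by apply/funext => f; rewrite /wdigit /centered (negbTE nn) expr0n.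
rewrite (wdigit_coord n nN n0).
have := average_coord_eq (Ordinal nN) ((1 - p) ^+ 2) (p ^+ 2).
rewrite (_ : (fun f : Omega => _) = fun f => ((f (Ordinal nN) == j0)%:R - p) ^+ 2).
  move=> ->; have := p_ge0; have := p_le1; rewrite !expr2; nra.
by apply/funext => f; case: eqP => _; rewrite ?sub0r ?sqrrN.
Qed.

Section Shift.
Variables (r : nat) (r_gt0 : (0 < r)%N).

Lemma wdigit_shift_depends n (phi psi : R -> R) :
  avg (fun f => phi (wdigit n f) * psi (wdigit (n + r) f)) =
  avg (fun f => phi (wdigit n f)) * avg (fun f => psi (wdigit (n + r) f)).
Proof.
apply: (@average_mul R _ _ j0 [set i | val i == n]%SET (fun f => phi (wdigit n f))
  (fun f => psi (wdigit (n + r) f))).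
  by move=> f g fg; rewrite (wdigit_depends n f g fg).
move=> f g fg; rewrite (wdigit_depends (n + r) f g) // => i; rewrite inE => /eqP ir.
by apply: fg; rewrite !inE ir; apply/eqP; clear -r_gt0; lia.
Qed.

(** In the quadratic bound for the exponential the linear term averages to 0, the two factors being
    independent and centred, and each squared factor contributes at most [p]. *)
Lemma average_exp_pair n (x : R) : `|x| <= 1 / 2 ->
  avg (fun f => expR (x * (wdigit n f * wdigit (n + r) f))) <= expR (2 * x ^+ 2 * p ^+ 2).
Proof.
move=> x12.
apply: le_trans (_ : avg (fun f => 1 + x * (wdigit n f * wdigit (n + r) f) +
   2 * x ^+ 2 * (wdigit n f ^+ 2 * wdigit (n + r) f ^+ 2)) <= _).
  apply: average_le => f.
  have -> : 2 * x ^+ 2 * (wdigit n f ^+ 2 * wdigit (n + r) f ^+ 2) =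
     2 * (x * (wdigit n f * wdigit (n + r) f)) ^+ 2 by ring.
  apply: expR_le_quadratic; rewrite !normrM.
  by apply: le_trans x12; rewrite ler_piMr // mulr_ile1 ?wdigit_norm.
rewrite !averageD !averageZ (average_cst _ _ _ j0).
rewrite (wdigit_shift_depends n id id) /= average_wdigit mul0r mulr0 addr0.
rewrite (wdigit_shift_depends n (fun x => x ^+ 2) (fun x => x ^+ 2)) /=.
apply: le_trans (expR_ge1Dx _); rewrite lerD2l ler_wpM2l ?(mulr_ge0 _ (sqr_ge0 _)) //.
rewrite expr2 ler_pM ?average_wdigit_sqr //; apply: average_ge0 => f; exact: sqr_ge0.
Qed.

(* Within one parity class of [n %/ r] the pairs {n, n + r} are disjoint. *)
Definition parity_class (b : bool) : seq nat :=
  [seq n <- index_iota 0 N | odd (n %/ r) == b].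

Lemma average_exp_class b (x : nat -> R) (lam : R) :
  0 <= lam <= 1 / 2 -> (forall n, `|x n| <= lam) ->
  avg (fun f => expR (\sum_(n <- parity_class b) x n * (wdigit n f * wdigit (n + r) f)))
  <= expR (2 * lam ^+ 2 * p ^+ 2 * N%:R).
Proof.
move=> /andP[lam0 lam12] xlam.
pose F n f := expR (x n * (wdigit n f * wdigit (n + r) f)).
pose D n : {set 'I_N} := [set i : 'I_N | (val i == n) || (val i == n + r)%N]%SET.
rewrite (_ : (fun f => _) = fun f => \prod_(n <- parity_class b) F n f); last first.
  by apply/funext => f; rewrite expR_sum.
rewrite (@average_prod R _ _ j0 _ D F); first last.
- move=> n m; rewrite !mem_filter => /andP[/eqP nb _] /andP[/eqP mb _] nm.
  rewrite -setI_eq0; apply/eqP/setP => i; rewrite !inE; apply/negP.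
  have odr k : odd ((k + r) %/ r) = ~~ odd (k %/ r).
    by rewrite addnC -{1}[r]mul1n divnMDl // add1n oddS.
  case/andP => /orP[] /eqP -> /orP[] /eqP.
  + by apply/eqP.
  + by move=> E; move: nb; rewrite E odr mb; case: (b).
  + by move=> E; move: mb; rewrite -E odr nb; case: (b).
  + by move/addIn/eqP; apply/negP.
- move=> n f g fg; rewrite /F (wdigit_depends n f g) ?(wdigit_depends (n + r) f g) //.
    by move=> i; rewrite inE => /eqP E; apply: fg; rewrite inE E eqxx orbT.
  by move=> i; rewrite inE => /eqP E; apply: fg; rewrite inE E eqxx.
- by rewrite filter_uniq // iota_uniq.
apply: le_trans (_ : \prod_(n <- parity_class b) expR (2 * lam ^+ 2 * p ^+ 2) <= _).
  apply: ler_prod => n _; apply/andP; split.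
    by apply: average_ge0 => f; apply: expR_ge0.
  apply: le_trans (average_exp_pair n (x n) (le_trans (xlam n) lam12)) _.
  rewrite ler_expR ler_wpM2r ?sqr_ge0 // ler_wpM2l //.
  by rewrite -[x n ^+ 2]real_normK ?num_real // ler_pXn2r // nnegrE.
rewrite -expR_sum ler_expR big_const_seq count_predT iter_addr_0 -[leLHS]mulr_natr.
rewrite ler_wpM2l ?mulr_ge0 ?sqr_ge0 // ler_nat.
by rewrite size_filter (leq_trans (count_size _ _)) // size_iota subn0.
Qed.

(** Exponential Markov inequality. If [|S| > 8 lam N p^2] then [lam |S| >= 2 E], so for one of the
    two signs one of the two parity classes reaches [E]: four cases. The exponent in
    [average_exp_class] is [E / 2], which leaves [- E / 2]. *)
Lemma average_large_correlation (c : nat -> R) (lam : R) :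
  0 <= lam <= 1 / 2 -> (forall n, `|c n| <= 1) ->
  avg (fun f => (~~ (`|\sum_(0 <= n < N) wdigit n f * wdigit (n + r) f * c n|
     <= 8 * lam * N%:R * p ^+ 2))%:R) <= 4 * expR (- (2 * lam ^+ 2 * N%:R * p ^+ 2)).
Proof.
move=> /andP[lam0 lam12] c1.
pose T b (s : R) f := \sum_(n <- parity_class b) (s * lam * c n) * (wdigit n f * wdigit (n + r) f).
set E := 4 * lam ^+ 2 * N%:R * p ^+ 2.
have TE b (s : R) : `|s| = 1 ->
    avg (fun f => expR (- E) * expR (T b s f)) <= expR (- (2 * lam ^+ 2 * N%:R * p ^+ 2)).
  move=> s1; rewrite averageZ.
  have := @average_exp_class b (fun n => s * lam * c n) lam.
  rewrite lam0 lam12 => /(_ isT) H.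
  apply: le_trans (ler_wpM2l (expR_ge0 _) (H _)) _.
    move=> n; rewrite !normrM s1 mul1r ger0_norm //.
    by rewrite -[leRHS]mulr1 ler_wpM2l.
  by rewrite -expRD ler_expR /E le_eqVlt; apply/orP; left; apply/eqP; ring.
apply: le_trans (_ : avg (fun f => (expR (- E) * expR (T false 1 f) + expR (- E) * expR (T true 1 f))
   + (expR (- E) * expR (T false (-1) f) + expR (- E) * expR (T true (-1) f))) <= _); last first.
  rewrite !averageD.
  have n1 : `|1 : R| = 1 by rewrite normr1.
  have nn1 : `|-1 : R| = 1 by rewrite normrN1.
  have := TE false 1 n1; have := TE true 1 n1.
  have := TE false (-1) nn1; have := TE true (-1) nn1.
  by lra.
apply: average_le => f.
set S := \sum_(0 <= n < N) _.
have ES s : T false s f + T true s f = s * lam * S.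
  rewrite /T /S mulr_sumr /parity_class !big_filter [RHS](bigID (fun n => odd (n %/ r) == false)) /=.
  congr (_ + _); first by apply: eq_bigr => n _; ring.
  by apply: eq_big => [n|n _]; [case: odd | ring].
have ex y : 0 <= expR (- E) * expR y by rewrite mulr_ge0 ?expR_ge0.
have sum0 s : 0 <= expR (- E) * expR (T false s f) + expR (- E) * expR (T true s f).
  by rewrite addr_ge0.
case: (leP (`|S|) _) => HS /=; rewrite ?mulr0n ?mulr1n; first by rewrite addr_ge0.
have big s : 8 * lam * N%:R * p ^+ 2 < s * S ->
    1 <= expR (- E) * expR (T false s f) + expR (- E) * expR (T true s f).
  move=> sS; have : 2 * E <= T false s f + T true s f.
    rewrite ES (_ : 2 * E = lam * (8 * lam * N%:R * p ^+ 2)); last by rewrite /E; ring.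
    by rewrite (_ : s * lam * S = lam * (s * S)) ?ler_wpM2l ?(ltW sS) //; ring.
  have one y : E <= y -> 1 <= expR (- E) * expR y.
    by move=> Ey; rewrite -expRD -expR0 ler_expR; lra.
  case: (leP E (T false s f)) => [/one h _|h1 h2].
    by rewrite ler_wpDr.
  by rewrite ler_wpDl // one //; lra.
move: HS; rewrite real_ltr_normr ?num_real // => /orP[] HS.
  by apply: ler_wpDr => //; apply: big; rewrite mul1r.
by apply: ler_wpDl => //; apply: big; rewrite mulN1r.
Qed.
End Shift.

(** Union bound over [N] shifts, [3N] frequencies, cosine and sine, with 4 exponentials each: 24 in
    all. *)
Lemma average_not_pseudorandom (lam : R) : 0 <= lam <= 1 / 2 ->
  avg (fun f => (~~ pseudorandom R N (wdigit ^~ f) (8 * lam * N%:R * p ^+ 2))%:R)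
  <= 24 * N%:R ^+ 2 * expR (- (2 * lam ^+ 2 * N%:R * p ^+ 2)).
Proof.
move=> lam01.
set tau := 8 * lam * N%:R * p ^+ 2; set e := expR _.
pose bad (cf : nat -> R) r f : R :=
  (~~ (`|\sum_(0 <= n < N) wdigit n f * wdigit (n + r) f * cf n| <= tau))%:R.
pose term (r xi : nat) f :=
  if (0 < r)%N then bad (cos_coef R (3 * N) xi) r f + bad (sin_coef R (3 * N) xi) r f else 0.
have term0 r xi f : 0 <= term r xi f.
  by rewrite /term; case: ifP => // _; rewrite addr_ge0 // ler0n.
apply: le_trans (_ : avg (fun f => \sum_(0 <= r < N) \sum_(0 <= xi < 3 * N) term r xi f) <= _).
  apply: average_le => f; rewrite /pseudorandom.
  case: forallP => [_|] /=; first by rewrite sumr_ge0 // => r _; rewrite sumr_ge0.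
  move=> /existsNP[r /negP]; rewrite negb_forall => /existsP[xi].
  rewrite negb_imply negb_and => /andP[r0 H].
  rewrite big_mkord (bigD1 r) //= big_mkord (bigD1 xi) //= -addrA.
  apply: ler_wpDr; first by rewrite addr_ge0 ?sumr_ge0 // => i _; rewrite sumr_ge0.
  rewrite /term r0 /bad; case/orP: H => ->; rewrite ?lerDl ?lerDr ?ler0n //.
rewrite (average_sum _ _ _ (fun r f => \sum_(0 <= xi < 3 * N) term r xi f)).
apply: le_trans (_ : \sum_(0 <= r < N) \sum_(0 <= xi < 3 * N) (8 * e) <= _); last first.
  rewrite !sumr_const_nat !subn0 -[leLHS]mulr_natr -[_ *+ (3 * N)]mulr_natr natrM.
  by rewrite le_eqVlt; apply/orP; left; apply/eqP; ring.
apply: sum_le_nat => r _; rewrite (average_sum _ _ _ (term r)); apply: sum_le_nat => xi _.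
case: (boolP (0 < r)%N) => r0; last first.
  rewrite /term (negbTE r0).
  by rewrite (average_cst _ _ _ j0) mulr_ge0 // expR_ge0.
rewrite /term r0 averageD.
have lc := average_large_correlation r r0 _ lam lam01.
have h1 := lc (cos_coef R (3 * N) xi) ltac:(by move=> n; rewrite ler_norml cos_geN1 cos_le1).
have h2 := lc (sin_coef R (3 * N) xi) ltac:(by move=> n; rewrite ler_norml sin_geN1 sin_le1).
by rewrite -/tau -/e in h1 h2; rewrite /bad; lra.
Qed.
End RandomDigits.

Local Open Scope classical_set_scope.
Local Open Scope ring_scope.

(** * Digits of a uniform real number *)

Section FracPart.
Variable R : realType.
Implicit Types x y : R.

Lemma frac_part_ge0 x : 0 <= frac_part x.
Proof. by rewrite subr_ge0; have /andP[] := floor_itv x. Qed.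

Lemma frac_part_lt1 x : frac_part x < 1.
Proof. by rewrite ltrBlDl; have /andP[_] := floor_itv x; rewrite intrD. Qed.

Lemma frac_part_id x : 0 <= x < 1 -> frac_part x = x.
Proof.
move=> x01; rewrite /frac_part (_ : Num.floor x = 0) ?subr0 //.
by apply: floor_def; rewrite add0r.
Qed.

Lemma frac_part_mulr_nat (B : nat) x :
  B%:R * frac_part x = (Num.truncn (B%:R * frac_part x))%:R + frac_part (B%:R * x).
Proof.
have h : 0 <= B%:R * frac_part x by rewrite mulr_ge0 ?frac_part_ge0.
have -> : frac_part (B%:R * x) = frac_part (B%:R * frac_part x).
  have e : B%:R * x = B%:R * frac_part x + (Posz B * Num.floor x)%:~R.
    by rewrite intrM /frac_part -pmulrn; ring.
  by rewrite e /frac_part floorDrz ?intr_int // intrKfloor intrD opprD addrACA subrr addr0.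
have fl : (Num.truncn (B%:R * frac_part x))%:R = (Num.floor (B%:R * frac_part x))%:~R :> R.
  rewrite truncn_floor h; have : 0 <= Num.floor (B%:R * frac_part x) by rewrite floor_ge0.
  by case: (Num.floor _) => // n _; rewrite absz_nat -pmulrn.
by rewrite fl [X in _ = _ + X]/frac_part addrC subrK.
Qed.
End FracPart.

Section Digits.
Variables (R : realType) (N B : nat) (B_gt0 : (0 < B)%N).
Local Notation Omega := {ffun 'I_N -> 'I_B}.
Local Notation mu := (@lebesgue_measure R).
Let b : R := B%:R.
Let b_gt0 : 0 < b. Proof. by rewrite ltr0n. Qed.

(** Positions count from 0: this is the first digit after the point of [b ^+ n * y], and it vanishes
    when that fractional part is below [1 / b]. *)
Definition digit (y : R) (n : nat) : nat := Num.truncn (b * frac_part (b ^+ n * y)).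

Definition digits (y : R) : Omega := [ffun i : 'I_N => insubd (Ordinal B_gt0) (digit y i)].

Lemma digit_lt y n : (digit y n < B)%N.
Proof.
rewrite truncn_lt_nat ?mulr_ge0 ?frac_part_ge0 ?(ltW b_gt0) //.
by rewrite -/b gtr_pMr ?frac_part_lt1.
Qed.

Lemma digitsE y (i : 'I_N) : digits y i = digit y i :> nat.
Proof. by rewrite ffunE insubdK //; exact: digit_lt. Qed.

Lemma frac_part_lt_of_zero_digit y n :
  zero_digit N B (digits y) n -> frac_part (b ^+ n * y) < b^-1.
Proof.
rewrite /zero_digit; case: insubP => // i _ <-; rewrite /= digitsE /digit.
move=> /eqP/truncn0Pn; rewrite -ltNge => H.
by rewrite -[_^-1]mul1r ltr_pdivlMr // mulrC.
Qed.

Definition digit_sum (f : Omega) : R := \sum_(i < N) (f i)%:R / b ^+ i.+1.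

Lemma digit_sumE y : 0 <= y < 1 ->
  y = digit_sum (digits y) + frac_part (b ^+ N * y) / b ^+ N.
Proof.
move=> y01; rewrite /digit_sum (eq_bigr (fun i : 'I_N => (digit y i)%:R / b ^+ i.+1));
  last by move=> i _; rewrite digitsE.
elim: N => [|k IH]; first by rewrite big_ord0 !expr0 mul1r divr1 add0r frac_part_id.
rewrite big_ord_recr /= {1}IH -addrA; congr (_ + _).
have bk k' : b ^+ k' != 0 by rewrite expf_neq0 // gt_eqF.
have := frac_part_mulr_nat R B (b ^+ k * y); rewrite -/b -/(digit y k) => h.
rewrite exprS -[b * _ * y]mulrA -mulrDl -h; field.
by rewrite bk gt_eqF.
Qed.

(** Only an upper bound for the measure of a digit event is wanted. A cover by closed intervals is
    measurable at once, and overlaps at end points do no harm to subadditivity. *)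
Definition digit_cover (P : pred Omega) : set R :=
  \big[setU/set0]_(f | P f) `[digit_sum f, digit_sum f + b ^- N]%classic.

Lemma measurable_digit_cover (P : pred Omega) : measurable (digit_cover P).
Proof. by apply: bigsetU_measurable => f _; exact: measurable_itv. Qed.

Lemma digit_coverP (P : pred Omega) y : 0 <= y < 1 -> P (digits y) -> digit_cover P y.
Proof.
move=> y01 Py; rewrite /digit_cover (bigD1 (digits y)) //=; left => /=.
have bN : 0 < b ^+ N by rewrite exprn_gt0.
rewrite in_itv /=; apply/andP; split.
  by rewrite [leRHS](digit_sumE y y01) lerDl divr_ge0 ?frac_part_ge0 ?(ltW bN).
rewrite [leLHS](digit_sumE y y01) lerD2l ler_pdivrMr // mulVf ?gt_eqF //.
by rewrite ltW // frac_part_lt1.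
Qed.

Lemma measure_digit_cover (P : pred Omega) :
  (mu (digit_cover P) <= (average R _ _ (fun f : Omega => (P f)%:R))%:E)%E.
Proof.
have bN : 0 < b ^+ N by rewrite exprn_gt0.
have -> : average R _ _ (fun f : Omega => (P f)%:R) = \sum_(f | P f) b ^- N.
  rewrite /average card_ffun !card_ord natrX -/b mulr_suml [RHS]big_mkcond.
  by apply: eq_bigr => f _; case: (P f); rewrite ?mul1r ?mul0r.
rewrite -sumEFin /digit_cover.
apply: (big_rec2 (fun (A : set R) (x : \bar R) => measurable A /\ (mu A <= x)%E) _ _).2.
  by split; rewrite ?measure0.
move=> f A x _ [mA Ax]; split; first by apply: measurableU => //; exact: measurable_itv.
apply: le_trans (measureU2 _ _ _) _ => //; try exact: measurable_itv.
apply: leeD => //.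
have E : mu `[digit_sum f, digit_sum f + b ^- N]%classic = (b ^- N)%:E.
  rewrite lebesgue_measure_itv /= lte_fin ltrDl invr_gt0 bN.
  by rewrite -EFinB addrAC subrr add0r.
by rewrite -E.
Qed.
End Digits.

(** * The Borel-Cantelli step *)

Lemma borel_cantelli_geometric (R : realType) (F : nat -> set R) (C : R) :
  (forall l, measurable (F l)) ->
  (forall l, (@lebesgue_measure R (F l) <= (C / 2 ^+ l)%:E)%E) ->
  (@lebesgue_measure R).-negligible (lim_sup_set F).
Proof.
move=> mF HF; exists (lim_sup_set F); split => //.
  apply: bigcap_measurable => //. move=> k _; apply: bigcup_measurable => j _. exact: mF.
apply: lim_sup_set_cvg0 => //.
apply: le_lt_trans (_ : (\sum_(0 <= l <oo) (C / 2 ^+ l)%:E < +oo)%E); last first.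
  have := @cvg_geometric_eseries_half R (2 * C) 0.
  rewrite (_ : (fun k => _) = fun l => (C / 2 ^+ l)%:E).
    by move/cvg_lim => -> //; rewrite ltry.
  apply/funext => l; congr (_%:E).
  rewrite addn1 natrX exprS; field. by rewrite expf_neq0.
by apply: lee_nneseries => // l _; exact: HF.
Qed.

(** * Choice of the scales *)

Lemma bernoulli_ineq (R : realDomainType) (h : R) n : 0 <= h -> 1 + n%:R * h <= (1 + h) ^+ n.
Proof.
move=> h0; elim: n => [|n IH]; first by rewrite mul0r addr0 expr0.
rewrite exprS -natr1; apply: le_trans (ler_wpM2l _ IH); last by rewrite addr_ge0.
have : 0 <= n%:R * h * h by rewrite !mulr_ge0.
by lra.
Qed.

(** Here [a < 1 / 2] enters: differences may reach about [2^(l/a)], while [N p^2] with [p = 2^-l]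
    grows only if [N] outgrows [4^l]. *)
Lemma powR_inv_gt4 (R : realType) (a : R) : 0 < a -> a < 1 / 2 -> 4 < 2 `^ a^-1.
Proof.
move=> a0 a2; have -> : 4 = 2 `^ 2%:R :> R by rewrite powR_mulrn // expr2; ring.
have n2 : (2 : R) == 0 = false by rewrite pnatr_eq0.
rewrite /powR n2 ltr_expR ltr_pM2r ?ln_gt0 ?ltr1n //.
by rewrite -[a^-1]mul1r ltr_pdivlMr //; lra.
Qed.

(** Of the six factors [1 + h], four make [N p^2] grow and two absorb the factor [l] in the
    differences [l * n]. *)
Lemma exists_base_gap (R : realFieldType) (s : R) : 4 < s ->
  exists2 h, 0 < h & 4 * (1 + h) ^+ 6 < s.
Proof.
move=> s4; have e0 : 0 < (s - 4) / 256 by lra.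
(* For [h <= 1] the expansion is at most [4 + 252 * h], and 252 is below 256. *)
exists (Num.min 1 ((s - 4) / 256)); first by rewrite lt_min ltr01 e0.
set h := Num.min _ _.
have h1 : h <= 1 by rewrite ge_min lexx.
have h2 : h <= (s - 4) / 256 by rewrite ge_min lexx orbT.
have h0 : 0 <= h by rewrite le_min ler01 ltW.
have hn k : h ^+ k.+1 <= h.
  by rewrite exprS ler_piMr // exprn_ile1.
have -> : 4 * (1 + h) ^+ 6 = 4 + 24 * h + 60 * h ^+ 2 + 80 * h ^+ 3 + 60 * h ^+ 4
  + 24 * h ^+ 5 + 4 * h ^+ 6 by ring.
have := hn 1%N; have := hn 2%N; have := hn 3%N; have := hn 4%N; have := hn 5%N.
by lra.
Qed.

Lemma expRN_le_poly (R : realType) (x : R) k : 0 < x ->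
  expR (- x) <= k.+1`!%:R / x ^+ k.+1.
Proof.
move=> x0; have := @expR_ge1Dxn R x k (ltW x0) => H.
rewrite expRN -[leRHS]invrK lef_pV2 ?posrE ?expR_gt0 ?invr_gt0 ?divr_gt0 ?exprn_gt0 ?ltr0n ?fact_gt0 //.
by rewrite invf_div; apply: le_trans H; rewrite lerDr.
Qed.

Lemma upper_density_gt0 (R : realType) (A : set nat) : (0 < upper_density R A)%E ->
  exists2 delta : R, 0 < delta & forall T0, exists2 T, (T0 <= T)%N &
    delta * T%:R <= \sum_(0 <= k < T) `[< A k.+1 >]%:R.
Proof.
rewrite /upper_density /limn_esup /limf_esup; set u := (fun N : nat => _).
set L := ereal_inf _ => L0.
have [delta d0 dL] : exists2 delta : R, 0 < delta & (delta%:E < L)%E.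
  case: L L0 => [r| |] //; last by exists 1; rewrite ?ltr01 ?ltry.
  by rewrite lte_fin => r0; exists (r / 2); rewrite ?lte_fin; lra.
exists delta => // T0.
have : (delta%:E < ereal_sup (u @` [set k | (T0 <= k)%N]))%E.
  apply: lt_le_trans dL _; apply: ereal_inf_lbound.
  by exists [set k | (T0 <= k)%N] => //; exists T0.
move/ereal_sup_gt => [_ [T T0T <-]]; rewrite /u lte_fin => H; exists T => //.
have -> : \sum_(0 <= k < T) (`[< A k.+1 >])%:R =
   #|` fset_set (A `&` [set k | (1 <= k <= T)%N])|%:R :> R.
  pose s := [seq k <- iota 1 T | `[< A k >]].
  have -> : fset_set (A `&` [set k | (1 <= k <= T)%N]) = [fset x in s]%fset.
    apply/fsetP => k.
    have fin : finite_set (A `&` [set k | (1 <= k <= T)%N]).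
      by apply: (sub_finite_set _ (finite_II T.+1)) => z /= [_ /andP[_ zT]]; rewrite ltnS.
    rewrite in_fset_set // in_fset /= mem_filter mem_iota add1n ltnS.
    apply/idP/idP => [|/andP[/asboolP Ak kT]]; last by rewrite inE.
    by rewrite inE => -[Ak /= ->]; rewrite andbT; apply/asboolP.
  rewrite card_fseq undup_id ?filter_uniq ?iota_uniq // size_filter -sum1_count.
  have -> : iota 1 T = index_iota 1 T.+1 by rewrite /index_iota subSS subn0.
  rewrite natr_sum big_add1 /= [RHS]big_mkcond /=.
  by apply: eq_bigr => k _; case: asboolP.
case: (posnP T) H => [->|Tp] H; first by rewrite mulr0.
by rewrite -ler_pdivlMr ?ltr0n // ltW.
Qed.

(** Provides the strict inequality [0 < frac_part (2 ^+ n * y)]: it fails only at dyadic rationals,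
    which are countable. *)
Lemma dyadic_negligible (R : realType) :
  (@lebesgue_measure R).-negligible
    [set y | 0 <= y <= 1 /\ exists n, frac_part (2 ^+ n * y) = 0].
Proof.
have null : (@lebesgue_measure R).-negligible (\bigcup_n \bigcup_k [set k%:R / 2 ^+ n : R]).
  apply: negligible_bigcup => n; apply: negligible_bigcup => k.
  by exists [set k%:R / 2 ^+ n]; split => //; exact: lebesgue_measure_set1.
apply: negligibleS null => y /= [/andP[y0 _] [n fn]].
exists n => //; exists (Num.truncn (2 ^+ n * y)) => //=.
have t0 : 0 <= 2 ^+ n * y by rewrite mulr_ge0 ?exprn_ge0.
move/eqP: fn; rewrite subr_eq0 => /eqP fn.
have -> : (Num.truncn (2 ^+ n * y))%:R = 2 ^+ n * y.
  rewrite [RHS]fn truncn_floor t0; have : 0 <= Num.floor (2 ^+ n * y) by rewrite floor_ge0.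
  by case: (Num.floor _) => // m _; rewrite absz_nat -pmulrn.
by rewrite mulrC mulKf // expf_neq0.
Qed.

Section Scales.
Variables (R : realType) (h : R) (h_gt0 : 0 < h).
Local Notation tau := (1 + h).
Let rho : R := 4 * tau ^+ 4.

(* If 4 tau^6 < 2^(1/a) then l * scale_length l <= 2^(l/a) for large l, so that
   2^-l <= n^-a for all the differences n in use; on the other hand
   N p^2 >= tau^(4l) / 2 for N = scale_length l and p = 2^-l. *)
Definition scale_length (l : nat) : nat := Num.truncn (rho ^+ l).
(** It tends to 0, hence falls below any constant coming from the density of [A], yet so slowly that
    [2 lam^2 N p^2] is still at least [tau ^+ (2 * l) / 4]. The factor 1/2 keeps it in the range
    [lam <= 1 / 2] of the exponential estimate. *)
Definition scale_slack (l : nat) : R := (tau ^+ l)^-1 / 2.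
Local Notation Nl := scale_length.
Local Notation lam := scale_slack.

Lemma tau_ge1 : 1 <= tau. Proof. by rewrite lerDl ltW. Qed.

Lemma tauX_ge1 n : 1 <= tau ^+ n. Proof. exact: exprn_ege1 tau_ge1. Qed.

Lemma rho_ge : tau ^+ 4 <= rho.
Proof. by rewrite /rho ler_peMl ?ler1n // exprn_ge0 // (le_trans ler01 tau_ge1). Qed.

Lemma rho_ge1 : 1 <= rho. Proof. exact: le_trans (tauX_ge1 4) rho_ge. Qed.

Lemma scale_length_le l : (Nl l)%:R <= rho ^+ l.
Proof. by rewrite truncn_le exprn_ge0 // (le_trans ler01 rho_ge1). Qed.

Lemma scale_length_ge l : rho ^+ l <= 2 * (Nl l)%:R.
Proof.
have r1 : 1 <= rho ^+ l by exact: exprn_ege1 rho_ge1.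
have := truncnS_gt (rho ^+ l); rewrite -/(Nl l) -natr1.
have : 1 <= (Nl l)%:R :> R by rewrite ler1n truncn_gt0.
by lra.
Qed.

Lemma scale_length_gt0 l : (0 < Nl l)%N.
Proof. by rewrite truncn_gt0 exprn_ege1 // rho_ge1. Qed.

Lemma scale_length_mono i j : (i <= j)%N -> (Nl i <= Nl j)%N.
Proof. by move=> ij; apply: le_truncn; rewrite ler_weXn2l // rho_ge1. Qed.

Lemma scale_length_sqr l : tau ^+ (4 * l) <= 2 * ((Nl l)%:R * ((2 ^ l)%N%:R^-1) ^+ 2).
Proof.
have : rho ^+ l * ((2 ^ l)%N%:R^-1) ^+ 2 <= 2 * (Nl l)%:R * ((2 ^ l)%N%:R^-1) ^+ 2.
  by rewrite ler_wpM2r ?sqr_ge0 ?scale_length_ge.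
rewrite -mulrA; apply: le_trans; rewrite le_eqVlt; apply/orP; left; apply/eqP.
have -> : rho ^+ l = (2 ^+ l) ^+ 2 * tau ^+ (4 * l).
  have e4 : (4 : R) ^+ l = 2 ^+ (2 * l) by rewrite exprM; congr (_ ^+ _); ring.
  by rewrite /rho exprMn e4 -!exprM [(l * 2)%N]mulnC.
by rewrite natrX; field; rewrite expf_neq0.
Qed.

Definition bad_event (l : nat) : set R :=
  @digit_cover R (Nl l) (2 ^ l)
    (fun f => ~~ pseudorandom R (Nl l) (wdigit R (Nl l) (2 ^ l) ^~ f)
      (8 * lam l * (Nl l)%:R * ((2 ^ l)%N%:R^-1) ^+ 2)).

Lemma bad_event_measure : exists C : R, forall l,
  (@lebesgue_measure R (bad_event l) <= (C / 2 ^+ l)%:E)%E.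
Proof.
(* Bernoulli's inequality then gives [2 * rho ^+ 2 <= tau ^+ (2 * K.+1)]: the bound of order [K.+1]
   for the exponential pays for [N^2 <= rho ^+ (2 * l)] and for a further factor [2 ^+ l]. *)
pose K := Num.bound (2 * rho ^+ 2 / h).
pose C : R := 24 * (4 ^+ K.+1 * K.+1`!%:R).
exists C => l.
have B0 : (0 < 2 ^ l)%N by rewrite expn_gt0.
apply: le_trans (measure_digit_cover R (Nl l) (2 ^ l) B0 _) _; rewrite lee_fin.
have t0 n : 0 < tau ^+ n by apply: lt_le_trans (tauX_ge1 n).
have lam01 : 0 <= lam l <= 1 / 2.
  rewrite /lam divr_ge0 ?invr_ge0 ?(ltW (t0 _)) //= ler_pM2r ?invr_gt0 //.
  by rewrite invf_le1 ?tauX_ge1.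
apply: le_trans (@average_not_pseudorandom R (Nl l) (2 ^ l) B0 (lam l) lam01) _.
set x := 2 * lam l ^+ 2 * _ * _.
have xge : tau ^+ (2 * l) / 4 <= x.
  have -> : x = (tau ^+ (2 * l))^-1 / 4 * (2 * ((Nl l)%:R * ((2 ^ l)%N%:R^-1) ^+ 2)).
    rewrite /x /scale_slack mulnC exprM; move: (t0 l) ((2 ^ l)%N%:R^-1); move: (tau ^+ l) => u u0 p.
    by field; rewrite gt_eqF.
  apply: le_trans (ler_wpM2l _ (scale_length_sqr l)).
    rewrite (_ : 4 * l = 2 * l + 2 * l)%N; last by lia.
    rewrite exprD; move: (t0 (2 * l)%N); move: (tau ^+ (2 * l)) => u u0.
    by rewrite le_eqVlt; apply/orP; left; apply/eqP; field; rewrite gt_eqF.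
  by rewrite divr_ge0 // invr_ge0 ltW.
have x0 : 0 < tau ^+ (2 * l) / 4 by rewrite divr_gt0.
apply: le_trans (_ : 24 * (Nl l)%:R ^+ 2 * expR (- (tau ^+ (2 * l) / 4)) <= _).
  by rewrite ler_wpM2l ?mulr_ge0 ?exprn_ge0 // ler_expR lerN2.
have rho0 : 0 < rho by apply: lt_le_trans rho_ge1.
have N2 : (Nl l)%:R ^+ 2 <= rho ^+ l ^+ 2.
  by rewrite lerXn2r ?nnegrE ?exprn_ge0 ?(ltW rho0) // scale_length_le.
have tK : 2 * rho ^+ 2 <= tau ^+ (2 * K.+1).
  have b1 := bernoulli_ineq R h (2 * K.+1) (ltW h_gt0).
  have : 2 * rho ^+ 2 / h < K%:R.
    by apply: archi_boundP; rewrite divr_ge0 ?(ltW h_gt0) // mulr_ge0 // sqr_ge0.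
  rewrite ltr_pdivrMr // => b2; apply: le_trans (le_trans (ltW b2) _) b1.
  apply: ler_wpDl => //; rewrite ler_wpM2r ?(ltW h_gt0) // ler_nat.
  by clear; lia.
have c0 : 0 <= 4 ^+ K.+1 * K.+1`!%:R :> R by apply: mulr_ge0 => //; exact: exprn_ge0.
have ex := expRN_le_poly R _ K x0.
have e2 : expR (- (tau ^+ (2 * l) / 4)) <= 4 ^+ K.+1 * K.+1`!%:R / (2 * rho ^+ 2) ^+ l.
  apply: le_trans ex _; rewrite expr_div_n invf_div mulrA -(mulrC (4 ^+ K.+1)).
  rewrite ler_wpM2l //.
  have rK : 0 < (2 * rho ^+ 2) ^+ l by rewrite exprn_gt0 // mulr_gt0 // exprn_gt0.
  rewrite lef_pV2 ?posrE ?(exprn_gt0 _ (t0 _)) //.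
  rewrite -exprM (_ : 2 * l * K.+1 = 2 * K.+1 * l)%N; last by rewrite mulnAC.
  rewrite exprM lerXn2r ?nnegrE ?(ltW (t0 _)) //.
  by rewrite mulr_ge0 // sqr_ge0.
apply: le_trans (_ : 24 * rho ^+ l ^+ 2 * (4 ^+ K.+1 * K.+1`!%:R / (2 * rho ^+ 2) ^+ l) <= _).
  by apply: ler_pM; rewrite ?expR_ge0 ?mulr_ge0 ?sqr_ge0 // ler_wpM2l.
rewrite le_eqVlt; apply/orP; left; apply/eqP.
rewrite /C [(2 * rho ^+ 2) ^+ l]exprMn (exprAC _ 2 l).
have : rho ^+ l != 0 by rewrite expf_neq0 // gt_eqF.
have : (2 : R) ^+ l != 0 by rewrite expf_neq0.
move: (4 ^+ K.+1 * _) (rho ^+ l) (2 ^+ l) => u v w w0 v0.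
by field; rewrite v0 w0.
Qed.

(** Upper density yields good lengths [T] only along some sequence. The least [l] with
    [T <= l * Nl l] overshoots by a factor of at most [4 * rho], since one step of [l] multiplies
    the length by no more. *)
Lemma dense_at_some_scale (delta : R) (A : pred nat) : 0 < delta ->
  (forall T0, exists2 T, (T0 <= T)%N &
    delta * T%:R <= \sum_(0 <= k < T) (A k.+1)%:R) ->
  forall L, exists2 l, (L < l)%N &
    delta / (4 * rho) * (l * Nl l)%:R <= \sum_(0 <= k < Nl l * l) (A k.+1)%:R.
Proof.
move=> d0 dense L.
(* [T] is beyond the length of scale [L.+1], which forces [L.+1 < l]. *)
have [T TL HT] := dense (L.+1 * Nl L.+1).+1.
have exl : exists l, (T <= l * Nl l)%N.
  by exists T; rewrite leq_pmulr // scale_length_gt0.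
case: (ex_minnP exl) => l Tl lmin.
have Ll : (L.+1 < l)%N.
  rewrite ltnNge; apply/negP => lL.
  have : (l * Nl l <= L.+1 * Nl L.+1)%N by rewrite leq_mul // scale_length_mono.
  by move: TL Tl; clear; lia.
exists l; first exact: ltnW.
case: l Tl lmin Ll => // l Tl lmin Ll.
have lT : (l * Nl l < T)%N.
  by rewrite ltnNge; apply/negP => /lmin; rewrite ltnn.
apply: le_trans (_ : delta * T%:R <= _).
  rewrite -mulrA ler_wpM2l ?(ltW d0) // ler_pdivrMl; last first.
    by rewrite mulr_gt0 // (lt_le_trans _ rho_ge1).
  apply: le_trans (_ : 4 * rho * (l * Nl l)%:R <= _); last first.
    rewrite ler_wpM2l ?ler_nat ?(ltnW lT) // mulr_ge0 //.
    exact: le_trans ler01 rho_ge1.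
  rewrite !natrM; apply: le_trans (_ : (2 * l%:R) * (rho * (2 * (Nl l)%:R)) <= _).
    apply: ler_pM => //.
      by rewrite -natrM ler_nat; move: Ll; clear; lia.
    apply: le_trans (scale_length_le l.+1) _; rewrite exprS ler_wpM2l ?scale_length_ge //.
    exact: le_trans ler01 rho_ge1.
  by rewrite le_eqVlt; apply/orP; left; apply/eqP; ring.
apply: le_trans HT _; rewrite [(Nl l.+1 * _)%N]mulnC.
rewrite [leRHS](@big_cat_nat _ _ _ T 0%N) //= lerDl.
by rewrite sumr_ge0.
Qed.

(** Some residue class modulo [l] inherits the density. A progression of difference [n] in the index
    [j] of [r + l * j] has difference [l * n] in [A], and the [n]-th digit in base [2^l] governs
    exactly [2 ^+ (l * n) * y]. *)
Lemma good_scale_hits (a : R) (y : R) (A : set nat) (l1 : nat) :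
  0 < a -> 4 * tau ^+ 6 < 2 `^ a^-1 -> 0 <= y < 1 ->
  (forall n, frac_part (2 ^+ n * y) <> 0) ->
  (forall l, (l1 <= l)%N -> ~ bad_event l y) ->
  (0 < upper_density R A)%E ->
  exists m n : nat, [/\ (0 < m)%N, (0 < n)%N,
        [set m; (m + n)%N; (m + 2 * n)%N] `<=` A
        & 0 < frac_part (2 ^+ n * y) < n%:R `^ (- a)].
Proof.
move=> a0 sig y01 ndy good /upper_density_gt0[delta d0 dense].
have rho0 : 0 < rho by apply: lt_le_trans rho_ge1.
pose delta' := delta / (4 * rho).
have d'0 : 0 < delta' by apply: divr_gt0 => //; apply: mulr_gt0.
have [c [N0 [c0 hits]]] := pseudorandom_difference R delta' d'0.
(* [2 * N0] ensures [N0 <= N] and [64 / c ^+ 2] the smallness condition; the last bound in [L] gives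
   [l <= (l * h) ^+ 2 <= tau ^+ (2 * l)]. *)
pose M : R := 2 * N0%:R + 64 / c ^+ 2 + 1.
have M0 : 0 <= M by rewrite !addr_ge0 ?mulr_ge0 // invr_ge0 sqr_ge0.
pose L := (l1 + 1 + Num.bound (M / h) + Num.bound (h ^+ 2)^-1)%N.
have [l Ll] := dense_at_some_scale delta (fun k => `[< A k >]) d0 dense L.
rewrite sum_nat_mul_residue -/delta' => Hl.
have [l1l l0 lM lh] : [/\ (l1 <= l)%N, (0 < l)%N, (Num.bound (M / h) <= l)%N
    & (Num.bound (h ^+ 2)^-1 <= l)%N].
  by move: Ll; rewrite /L; move: (Num.bound (M / h)) (Num.bound _) => u v Ll; split; clear -Ll; lia.
have {}lM : M <= l%:R * h.
  rewrite -ler_pdivrMr //; apply: le_trans (ltW (archi_boundP _)) _.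
    by rewrite divr_ge0 // ltW.
  by rewrite ler_nat.
have {}lh : 1 <= l%:R * h ^+ 2.
  rewrite -ler_pdivrMr ?exprn_gt0 // mul1r; apply: le_trans (ltW (archi_boundP _)) _.
    by rewrite invr_ge0 sqr_ge0.
  by rewrite ler_nat.
have tl : 1 + l%:R * h <= tau ^+ l := bernoulli_ineq R h l (ltW h_gt0).
have [r rl Hr] : exists2 r, (r < l)%N &
    delta' * (Nl l)%:R <= \sum_(0 <= j < Nl l) `[< A (r + l * j).+1 >]%:R.
  apply: exists_ge_sum_le => //.
  by rewrite sumr_const_nat subn0 -[leLHS]mulr_natl mulrCA -natrM.
clear dense Ll L Hl.
pose N := Nl l.
(* The residue class is moved into [[N, 2N)], where the counting lemmas want it; the successor
   passes from indices starting at 0 to positive integers. *)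
pose A' : pred nat := fun i => (N <= i < 2 * N)%N && `[< A (r + l * (i - N)).+1 >].
have B0 : (0 < 2 ^ l)%N by rewrite expn_gt0.
pose X := zero_digit N (2 ^ l) (digits R N (2 ^ l) B0 y).
pose p : R := (2 ^ l)%N%:R^-1.
have t0 : 0 < tau ^+ l by apply: lt_le_trans (tauX_ge1 l).
have lam0 : 0 <= lam l by rewrite divr_ge0 // invr_ge0 ltW.
have p01 : 0 <= p <= 1 by rewrite invr_ge0 ler0n invf_le1 ?ler1n ?ltr0n.
have Nr0 : 0 < N%:R :> R by rewrite ltr0n scale_length_gt0.
have NN0 : (N0 <= N)%N.
  rewrite -(ler_nat R).
  have h1 : tau ^+ l <= rho ^+ l.
    rewrite lerXn2r ?nnegrE ?(ltW rho0) ?(le_trans ler01 tau_ge1) //.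
    by apply: le_trans rho_ge; rewrite ler_eXnr // tau_ge1.
  have h2 := scale_length_ge l; rewrite -/N in h2.
  have h3 : 0 <= 64 / c ^+ 2 by rewrite divr_ge0 // sqr_ge0.
  by rewrite /M in lM; clear -lM tl h1 h2 h3; lra.
have sumA' : delta' * N%:R <= \sum_(0 <= i < 2 * N) (A' i)%:R.
  apply: le_trans Hr _; rewrite (@big_cat_nat _ _ _ N 0%N (2 * N)%N) //=; last first.
    by rewrite leq_pmull.
  apply: ler_wpDl; first by rewrite sumr_ge0.
  rewrite -[X in _ <= \sum_(X <= _ < _) _]add0n big_addn mul2n -addnn addnK.
  apply: sum_le_nat => j /andP[_ jN].
  by rewrite /A' addnK leq_addl mul2n -addnn ltn_add2r jN.
(* With [q = N p^2] this reads [2 + 32 * lam l * q < c ^+ 2 * q], which follows from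
   [lam l <= c ^+ 2 / 128] and [32 < c ^+ 2 * q]. *)
have smallt : N%:R ^+ 3 * (2 + 4 * (8 * lam l * N%:R * p ^+ 2)) < (c * p * N%:R ^+ 2) ^+ 2.
  pose q := N%:R * p ^+ 2.
  have -> : (c * p * N%:R ^+ 2) ^+ 2 = N%:R ^+ 3 * (c ^+ 2 * q) by rewrite /q; ring.
  rewrite ltr_pM2l ?exprn_gt0 // -[8 * lam l * _ * _]mulrA -/q.
  have u4 : tau ^+ l <= 2 * q.
    apply: le_trans (scale_length_sqr l); rewrite ler_weXn2l ?tau_ge1 //.
    by rewrite leq_pmull.
  have c2 : 0 < c ^+ 2 by rewrite exprn_gt0.
  have uc : 64 < tau ^+ l * c ^+ 2.
    rewrite -ltr_pdivrMr //; move: lM; rewrite /M => lM.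
    have n0 : 0 <= N0%:R :> R by [].
    by clear -lM tl n0; lra.
  have q0 : 0 <= q by rewrite mulr_ge0 ?sqr_ge0 // ltW.
  have lamu : lam l <= c ^+ 2 / 128.
    rewrite /lam ler_pdivrMr // -[leLHS]mul1r ler_pdivrMr //.
    by clear -uc; lra.
  have h1 : lam l * q <= c ^+ 2 / 128 * q by rewrite ler_wpM2r.
  have h2 : c ^+ 2 * tau ^+ l <= c ^+ 2 * (2 * q) by rewrite ler_wpM2l // ltW.
  by clear -h1 h2 uc; lra.
have psr : pseudorandom R N (centered R N p X) (8 * lam l * N%:R * p ^+ 2).
  apply: contrapT => /negP H; apply: (good l l1l).
  exact: (@digit_coverP R N (2 ^ l) B0 _ y y01 H).
have tau0' : 0 <= 8 * lam l * N%:R * p ^+ 2.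
  by apply: mulr_ge0 (sqr_ge0 _); do 2 apply: mulr_ge0 => //.
have supp i : A' i -> (N <= i < 2 * N)%N by case/andP.
have [t [n [/andP[n0 nN] Xn /and3P[At Atn At2n]]]] :=
  hits N A' X p _ NN0 supp sumA' p01 tau0' psr smallt.
exists (r + l * (t - N)).+1, (l * n)%N; split => //; first by rewrite muln_gt0 l0.
  have [tN _] := andP (supp _ At).
  have inA i : A' i -> A (r + l * (i - N)).+1 by case/andP => _ /asboolP.
  move=> _ [[->|->]|->]; first exact: inA.
    have := inA _ Atn; congr A.
    by rewrite addSn -addnA -mulnDr addnBAC.
  have := inA _ At2n; congr A.
  by rewrite addSn mulnCA -addnA -mulnDr addnBAC.
rewrite lt0r frac_part_ge0 andbT; apply/andP; split; first by apply/eqP.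
have := frac_part_lt_of_zero_digit R N (2 ^ l) B0 y n Xn.
rewrite natrX -exprM => /lt_le_trans; apply.
have l2 : 0 < 2 ^+ l :> R by rewrite exprn_gt0.
have ln0 : 0 < (l * n)%:R :> R by rewrite ltr0n muln_gt0 l0.
rewrite powRN lef_pV2 ?posrE ?powR_gt0 //.
have s0 : 0 <= 2 `^ a^-1 :> R by exact: powR_ge0.
(* After taking [a]-th roots the claim is [l * n <= 2^(l/a)], proved through
   [l * rho ^+ l <= (4 * tau ^+ 6) ^+ l]. *)
have -> : 2 ^+ l = ((2 `^ a^-1) ^+ l) `^ a :> R.
  by rewrite -(powR_mulrn l s0) -!powRrM mulrCA mulVf ?gt_eqF // mulr1 powR_mulrn.
apply: ge0_ler_powR; rewrite ?nnegrE ?(ltW a0) ?(ltW ln0) ?exprn_ge0 //.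
have r0 : 0 <= rho ^+ l by rewrite exprn_ge0 // ltW.
have key1 : (l * n)%:R <= l%:R * rho ^+ l.
  rewrite natrM ler_wpM2l //; apply: le_trans (scale_length_le l).
  by rewrite ler_nat ltnW.
apply: le_trans key1 _.
apply: le_trans (_ : rho ^+ l * (tau ^+ l) ^+ 2 <= _); last first.
  rewrite -exprM [(l * 2)%N]mulnC exprM -exprMn lerXn2r ?nnegrE //.
    by rewrite mulr_ge0 ?sqr_ge0 // ltW.
  by rewrite /rho -mulrA -exprD ltW.
rewrite mulrC ler_wpM2l //.
have h1 : (l%:R * h) ^+ 2 <= (tau ^+ l) ^+ 2.
  rewrite lerXn2r ?nnegrE ?mulr_ge0 ?(ltW h_gt0) ?(ltW t0) //.
  by apply: le_trans tl; rewrite lerDr.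
apply: le_trans h1; rewrite exprMn expr2 -mulrA ler_peMr //.
Qed.
End Scales.

Theorem corollary1p6 (R : realType) (a : R) (ha0 : 0 < a) (ha1 : a < 1 / 2) :
  {ae @lebesgue_measure R, forall y : R, 0 <= y <= 1 ->
    forall A : set nat, A `<=` [set k | (0 < k)%N] ->
      (0 < upper_density R A)%E ->
      exists m n : nat, [/\ (0 < m)%N, (0 < n)%N,
        [set m; (m + n)%N; (m + 2 * n)%N] `<=` A
        & 0 < frac_part (2 ^+ n * y) < n%:R `^ (- a)]}.
Proof.
have [h h0 hs] := exists_base_gap R _ (powR_inv_gt4 R a ha0 ha1).
have [C HC] := bad_event_measure R h h0.
have mF l : measurable (bad_event R h l) by exact: measurable_digit_cover.
have null := borel_cantelli_geometric R _ C mF HC.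
(* The exceptional points are the dyadic rationals and those in infinitely many bad events; neither
   set depends on [A]. *)
apply: negligibleS (negligibleU (dyadic_negligible R) null) => y.
apply: contraPP => /not_orP[ndy nbad] /=; apply => y01 A _ HA.
have nd n : frac_part (2 ^+ n * y) <> 0.
  by move=> fn; apply: ndy; split => //; exists n.
(* The end point 1 has fractional part 0, so it is already excluded as dyadic. *)
have y1 : 0 <= y < 1.
  case/andP: y01 => -> y1 /=; rewrite lt_neqAle y1 andbT.
  apply/eqP => E; apply: (nd 0%N); rewrite E expr0 mulr1 /frac_part.
  by rewrite -[X in Num.floor X]/(1%:~R) intrKfloor subrr.
have [l1 good] : exists l1, forall l, (l1 <= l)%N -> ~ bad_event R h l y.
  apply: contrapT => H; apply: nbad => l1 _; apply: contrapT => H1.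
  by apply: H; exists l1 => l ll bl; apply: H1; exists l.
exact: (good_scale_hits R h h0 a y A l1 ha0 hs y1 nd good HA).
Qed.
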